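(* Consider the following seven families of finite groups (all defined in the context), with the indicated parameters. 1. $(C_{p^2})^n$, $p$ prime, $n\ge1$. 2. $\mathbb{F}_q^d\rtimes C_r$, where $p\ne r$ are primes, $p$ has multiplicative order $r-1$ modulo $r$, $q=p^{r-1}$, $d\ge1$. 3. $A(n,\theta)$, where $n\ge1$ is not a power of $2$ and $\theta\in\mathrm{Aut}(\mathbb{F}_{2^n})$ has odd order greater than $1$. 4. $B(n)$, $n\ge1$. 5. $P$ (a single group of order $2^9$). 6. $\mathbb{F}_q^3{:}\mathbb{F}_q^3$, $q$ an odd prime power. 7. $\mathbb{F}_{p^n}{:}\mathbb{F}_{q}^{m/b}$, $p$ an odd prime, $q=p^b$, $n\mid b\mid m$, $m/b$ even. An irredundant list of pairwise non-isomorphic $3$-orbit groups is obtained from these families by making the following two restrictions: in family 3 take only $G=A(n,\phi^i)$ with $1\le i\le (n_{2'}-1)/2$, where $\phi=\theta_0^{\,n_2}$ (which has odd order $n_{2'}$) and $\theta_0\in\mathrm{Aut}(\mathbb{F}_{2^n})$ is $\theta_0(x)=x^2$; and in family 7 take only $b=n$. That is: every group in the restricted list is a $3$-orbit group, groups in the restricted list arising from different families or different parameters are non-isomorphic, and every group in the seven unrestricted families is isomorphic to a group in the restricted list.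
   Context: A group $G$ is a $3$-orbit group if $\mathrm{Aut}(G)$, acting naturally on $G$, has exactly $3$ orbits (including $\{1\}$). $C_k$ is the cyclic group of order $k$. For a positive integer $n$, $n_2$ is the largest power of $2$ dividing $n$ and $n_{2'}=n/n_2$. Family 2: $\mathbb{F}_q^d\rtimes C_r$ is the set $C_r\times\mathbb{F}_q^d$, with $C_r$ the subgroup of order $r$ of $\mathbb{F}_q^\times$, and multiplication $(\lambda,v)(\mu,w)=(\lambda\mu,\mu v+w)$. Family 3: with $q=2^n$, $A(n,\theta)=\mathbb{F}_q\times\mathbb{F}_q$ with multiplication $(\lambda_1,\zeta_1)(\lambda_2,\zeta_2)=(\lambda_1+\lambda_2,\ \zeta_1+\zeta_2+\lambda_1^\theta\lambda_2)$. Family 4: with $q=2^n$ and a fixed $\varepsilon\in\mathbb{F}_{q^2}^\times$ of order $q+1$, $B(n)=\mathbb{F}_{q^2}\times\mathbb{F}_q$ with multiplication $(\lambda_1,\zeta_1)(\lambda_2,\zeta_2)=(\lambda_1+\lambda_2,\ \zeta_1+\zeta_2+\lambda_1\lambda_2^q\varepsilon+(\lambda_1\lambda_2^q\varepsilon)^q)$; its isomorphism type does not depend on $\varepsilon$. Family 5: with $q=8$ and a fixed $\varepsilon\in\mathbb{F}_{64}^\times$ of order $63$, $P=\mathbb{F}_{64}\times\mathbb{F}_8$ with multiplication $(\lambda_1,\zeta_1)(\lambda_2,\zeta_2)=(\lambda_1+\lambda_2,\ \zeta_1+\zeta_2+\lambda_1\lambda_2^2\varepsilon+(\lambda_1\lambda_2^2\varepsilon)^q)$;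 its isomorphism type does not depend on $\varepsilon$. Family 6: $\mathbb{F}_q^3{:}\mathbb{F}_q^3$ is the set $\mathbb{F}_q^3\times\Lambda^2(\mathbb{F}_q^3)$ with multiplication $(v_1,w_1)(v_2,w_2)=(v_1+v_2,\ w_1+w_2+v_1\wedge v_2)$. Family 7: $\mathbb{F}_{p^n}{:}\mathbb{F}_q^{m/b}$ is the set $\mathbb{F}_q^{m/b}\times\mathbb{F}_{p^n}$ with multiplication $(v_1,\zeta_1)(v_2,\zeta_2)=(v_1+v_2,\ \zeta_1+\zeta_2+\mathrm{Tr}(f(v_1,v_2)))$, where $f$ is a non-degenerate alternating $\mathbb{F}_q$-bilinear form on $\mathbb{F}_q^{m/b}$ and $\mathrm{Tr}\colon\mathbb{F}_q\to\mathbb{F}_{p^n}$ is the field trace. (Its isomorphism type does not depend on the choice of $f$.) *)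

(* Defs.v *)
From HB Require Import structures.
From mathcomp Require Import all_boot all_order all_algebra all_fingroup.
From mathcomp Require Import all_solvable all_field.

Set Implicit Arguments.
Unset Strict Implicit.
Unset Printing Implicit Defensive.

Import GRing.Theory FinRing.Theory.
Local Open Scope ring_scope.

Definition three_orbit (G : finGroupType) : Prop :=
  #|orbit 'P (Aut [set: G]) @: [set: G]| = 3%N.

Record prime_nat := PrimeNat { pnat :> nat; prime_pnat : prime pnat }.
HB.instance Definition _ := [isSub for pnat].
HB.instance Definition _ := [Countable of prime_nat by <:].

Definition two : prime_nat := @PrimeNat 2 isT.

(* The field with p ^ n elements for n > 0; n = 0 is a junk value. *)
Definition GF (p : prime_nat) (n : nat) : finFieldType :=
  if n is m.+1 then s2val (pPrimePowerField (prime_pnat p) (ltn0Sn m))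
  else 'F_p.

Lemma GF_pchar (p : prime_nat) n : (p : nat) \in [pchar GF p n].
Proof.
case: n => [|n] /=; first exact: pchar_Fp (prime_pnat p).
exact: s2valP (pPrimePowerField (prime_pnat p) (ltn0Sn n)).
Qed.

Lemma card_GF (p : prime_nat) n : (0 < n)%N -> #|GF p n| = (p ^ n)%N.
Proof.
by case: n => // n _; exact: s2valP' (pPrimePowerField (prime_pnat p) (ltn0Sn n)).
Qed.

Lemma GF_expD (p : prime_nat) m n (x y : GF p m) :
  (x + y) ^+ (p ^ n) = x ^+ (p ^ n) + y ^+ (p ^ n).
Proof.
apply: exprDn_pchar; rewrite (eq_pnat _ (pcharf_eq (GF_pchar p m))).
by rewrite pnatX pnat_id ?prime_pnat.
Qed.

Lemma GF_expN (p : prime_nat) m n (x : GF p m) :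
  (- x) ^+ (p ^ n) = - x ^+ (p ^ n).
Proof.
apply/eqP; rewrite -addr_eq0 -GF_expD addNr expr0n.
by rewrite expn_eq0 -leqn0 leqNgt prime_gt0 ?prime_pnat.
Qed.

Lemma GF_exp0 (p : prime_nat) m n : (0 : GF p m) ^+ (p ^ n) = 0.
Proof. by rewrite expr0n expn_eq0 -leqn0 leqNgt prime_gt0 ?prime_pnat. Qed.

Lemma GF_exp_card (p : prime_nat) m (x : GF p m) : x ^+ (p ^ m) = x.
Proof.
case: m x => [|m] x; first by rewrite expn0 expr1.
by rewrite -(@card_GF p m.+1) // expf_card.
Qed.

(* For n %| m, the subfield with p ^ n elements of GF p m. *)
Definition subGF_pred (p : prime_nat) (m n : nat) : {pred GF p m} :=
  [pred x | x ^+ (p ^ n) == x].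

Fact subGF_zmod_closed p m n : zmod_closed (@subGF_pred p m n).
Proof.
split=> [|x y]; rewrite !inE ?GF_exp0 //= => /eqP Ex /eqP Ey.
by rewrite GF_expD GF_expN Ex Ey.
Qed.
HB.instance Definition _ p m n :=
  GRing.isZmodClosed.Build (GF p m) (@subGF_pred p m n)
    (subGF_zmod_closed p m n).

Record subGF (p : prime_nat) (m n : nat) : Type :=
  SubGF { subGF_val :> GF p m; _ : subGF_val \in @subGF_pred p m n }.
HB.instance Definition _ p m n := [isSub for @subGF_val p m n].
HB.instance Definition _ p m n := [Finite of subGF p m n by <:].
HB.instance Definition _ p m n :=
  [SubChoice_isSubZmodule of subGF p m n by <:].

Record biadditive (U V : zmodType) := Biadditive {
  bfun :> U -> U -> V;
  bfunDl : forall x y z, bfun (x + y) z = bfun x z + bfun y z;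
  bfunDr : forall x y z, bfun x (y + z) = bfun x y + bfun x z }.

(* The set U * V with (u1, v1) (u2, v2) = (u1 + u2, v1 + v2 + b u1 u2). *)
Definition cocycle_type (U V : finZmodType) (b : biadditive U V) : Type :=
  (U * V)%type.

Section CocycleGroup.

Variables (U V : finZmodType) (b : biadditive U V).
Local Notation T := (cocycle_type b).
HB.instance Definition _ := Finite.on T.

Definition cocycle_mul (x y : T) : T :=
  (x.1 + y.1, x.2 + y.2 + b x.1 y.1).
Definition cocycle_one : T := (0, 0).
Definition cocycle_inv (x : T) : T :=
  (- x.1, - x.2 + b x.1 x.1).

Fact bfun0l y : b 0 y = 0.
Proof. by apply: (addrI (b 0 y)); rewrite -bfunDl !addr0. Qed.
Fact bfunNl x y : b (- x) y = - b x y.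
Proof. by apply/eqP; rewrite -addr_eq0 -bfunDl addNr bfun0l. Qed.

Fact cocycle_mulA : associative cocycle_mul.
Proof.
move=> [x1 x2] [y1 y2] [z1 z2]; congr (_, _) => /=; first exact: addrA.
rewrite bfunDl bfunDr -!addrA; do 2!congr (_ + _).
by rewrite [RHS]addrCA; congr (_ + _); rewrite addrC -addrA.
Qed.
Fact cocycle_mul1 : left_id cocycle_one cocycle_mul.
Proof. by case=> x1 x2; congr (_, _); rewrite /= ?bfun0l ?addr0 add0r. Qed.
Fact cocycle_mulV : left_inverse cocycle_one cocycle_inv cocycle_mul.
Proof.
case=> x1 x2; congr (_, _); rewrite /= ?addNr //.
by rewrite bfunNl addrAC [- x2 + _]addrC addrAC addrNK addrN.
Qed.
HB.instance Definition _ := Finite_isGroup.Build T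
  cocycle_mulA cocycle_mul1 cocycle_mulV.
Definition cocycle_group : finGroupType := T.

End CocycleGroup.

(* (C_{p^2})^n *)
Definition homocyclic_p2 (p : prime_nat) (n : nat) : finGroupType :=
  ('rV['Z_(p ^ 2)]_n : finZmodType).

(* When r divides #|F| - 1 this is the subgroup of order r of F^x, see
   card_unit_roots. *)
Definition unit_roots (F : finFieldType) (r : nat) : {set {unit F}} :=
  [set u | (u ^+ r)%g == 1%g].

Fact unit_roots_group_set F r : group_set (unit_roots F r).
Proof.
apply/group_setP; split=> [|u v]; rewrite !inE ?expg1n // => /eqP Eu /eqP Ev.
by rewrite expgMn ?Eu ?Ev ?mulg1 //; apply: val_inj; rewrite /= mulrC.
Qed.
Canonical unit_roots_group (F : finFieldType) (r : nat) : {group {unit F}} :=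
   Group (unit_roots_group_set F r).

Lemma card_unit_roots (F : finFieldType) (r : nat) :
  (r %| #|F|.-1)%N -> #|unit_roots F r| = r.
Proof.
move=> r_dv; have /cyclicP[u defG] := field_unit_group_cyclic [set: {unit F}].
have ou : #[u]%g = #|F|.-1 by rewrite orderE -defG card_finField_unit.
have F_gt1 : (0 < #|F|.-1)%N by rewrite -ou order_gt0.
have r_gt0 : (0 < r)%N by apply: dvdn_gt0 r_dv.
have -> : unit_roots F r = <[u ^+ (#|F|.-1 %/ r)]>%g.
  apply/setP=> v; rewrite inE; apply/idP/idP => [/eqP vr|/cycleP[k ->]].
    have /cycleP[k vE] : v \in <[u]>%g by rewrite -defG inE.
    move: vr; rewrite vE -expgM => /eqP; rewrite -order_dvdn ou.
    rewrite -{1}(divnK r_dv) dvdn_pmul2r // => /dvdnP[l ->].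
    by rewrite mulnC expgM mem_cycle.
  rewrite -expgM mulnC expgM -(expgM u) divnK // -ou expg_order.
  by rewrite expg1n.
rewrite -orderE orderXdiv ou ?divn_divr ?dvdn_div //.
by rewrite divnA ?mulKn // dvdn_div.
Qed.

Lemma card_subGF (p : prime_nat) (m n : nat) :
  (0 < m)%N -> (n %| m)%N -> #|{: subGF p m n}| = (p ^ n)%N.
Proof.
move=> m_gt0 n_m; have n_gt0 : (0 < n)%N by apply: dvdn_gt0 n_m.
have q_gt0 : (0 < p ^ n)%N by rewrite expn_gt0 prime_gt0 ?prime_pnat.
have q1dv : ((p ^ n).-1 %| #|GF p m|.-1)%N.
  case/dvdnP: n_m => k mE; rewrite card_GF // mE mulnC expnM.
  by rewrite [((p ^ n) ^ k).-1]predn_exp dvdn_mulr.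
have F0 : 0 \in @subGF_pred p m n by rewrite inE GF_exp0.
rewrite card_sub (cardD1 0) F0 -[RHS]prednK // add1n.
congr _.+1; rewrite -(card_unit_roots q1dv) -(card_imset _ val_inj).
apply: eq_card => x; rewrite !inE; apply/andP/imsetP => [[x0 /eqP xq]|].
  have Ux : x \is a GRing.unit by rewrite unitfE.
  exists (FinRing.unit _ Ux) => //; rewrite inE; apply/eqP/val_inj.
  by rewrite val_unitX /=; apply: (mulfI x0); rewrite -exprS prednK // mulr1.
case=> u; rewrite inE => /eqP/(congr1 val); rewrite val_unitX /= => uq ->.
split; first by rewrite -unitfE (valP u).
by rewrite -[(p ^ n)%N]prednK // exprS uq mulr1.
Qed.

(* F^d : C_r, the set C_r * F^d with (l, v) (m, w) = (l m, m v + w). *)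
Section AffineGroup.

Variables (F : finFieldType) (r d : nat).

Definition affine_group : Type := ([subg unit_roots F r] * 'rV[F]_d)%type.
HB.instance Definition _ := Finite.on affine_group.

Definition scal (l : [subg unit_roots F r]) : F := val (sgval l).

Definition affine_mul (x y : affine_group) : affine_group :=
  ((x.1 * y.1)%g, scal y.1 *: x.2 + y.2).
Definition affine_one : affine_group := (1%g, 0).
Definition affine_inv (x : affine_group) : affine_group :=
  (x.1^-1%g, - (scal x.1^-1%g *: x.2)).

Fact scalM l m : scal (l * m)%g = scal l * scal m.
Proof. by []. Qed.
Fact affine_mulA : associative affine_mul.
Proof.
move=> [l u] [m v] [n w]; congr (_, _) => /=; first exact: mulgA.
by rewrite scalM scalerDr scalerA mulrC addrA.
Qed.
Fact affine_mul1 : left_id affine_one affine_mul.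
Proof. by case=> l u; congr (_, _); rewrite /= ?mul1g ?scaler0 ?add0r. Qed.
Fact affine_mulV : left_inverse affine_one affine_inv affine_mul.
Proof.
case=> l u; congr (_, _); rewrite /= ?mulVg //.
by rewrite scalerN scalerA -scalM mulgV scale1r addNr.
Qed.
HB.instance Definition _ := Finite_isGroup.Build affine_group
  affine_mulA affine_mul1 affine_mulV.

End AffineGroup.

Definition field_Aut (F : finFieldType) : {set {perm F}} :=
  [set t : {perm F} | [forall x, forall y,
     (t (x + y) == t x + t y) && (t (x * y) == t x * t y)]].

Lemma field_AutP (F : finFieldType) (t : {perm F}) :
  reflect ({morph t : x y / x + y} /\ {morph t : x y / x * y})
          (t \in field_Aut F).
Proof.
rewrite inE; apply: (iffP forallP) => [tM|[tD tM] x].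
  by split=> x y; have /forallP/(_ y)/andP[/eqP tD /eqP tM'] := tM x.
by apply/forallP=> y; rewrite tD tM !eqxx.
Qed.

Fact field_Aut_group_set F : group_set (field_Aut F).
Proof.
apply/group_setP; split=> [|s t /field_AutP[sD sM] /field_AutP[tD tM]];
  apply/field_AutP; split=> x y; rewrite ?perm1 // !permM.
- by rewrite sD tD.
- by rewrite sM tM.
Qed.
Canonical field_Aut_group F := Group (field_Aut_group_set F).

Section FamilyA.

Variables (n : nat) (theta : [subg field_Aut (GF two n)]).
Implicit Types x y z : GF two n.

Definition A_cocycle x y : GF two n := sgval theta x * y.

Fact A_cocycleDl x y z :
  A_cocycle (x + y) z = A_cocycle x z + A_cocycle y z.
Proof.
by have /field_AutP[tD _] := subgP theta; rewrite /A_cocycle tD mulrDl.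
Qed.
Fact A_cocycleDr x y z :
  A_cocycle x (y + z) = A_cocycle x y + A_cocycle x z.
Proof. exact: mulrDr. Qed.

Definition A_group : finGroupType :=
  cocycle_group (Biadditive A_cocycleDl A_cocycleDr).

End FamilyA.

(* The Frobenius automorphism theta_0 of F_{2^n}. *)
Section Frobenius2.

Variable n : nat.

Fact frob2_inj : injective (fun x : GF two n => x ^+ 2).
Proof. exact: (fmorph_inj (pFrobenius_aut (GF_pchar two n))). Qed.

Fact frob2_Aut : perm frob2_inj \in field_Aut (GF two n).
Proof.
apply/field_AutP; split=> x y; rewrite !permE; last exact: exprMn.
exact: (rmorphD (pFrobenius_aut (GF_pchar two n))).
Qed.

Definition theta0 : [subg field_Aut (GF two n)] := subg _ (perm frob2_inj).

Lemma theta0E x : sgval theta0 x = x ^+ 2.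
Proof. by rewrite subgK ?frob2_Aut // permE. Qed.

Definition phi : [subg field_Aut (GF two n)] := (theta0 ^+ (n`_2)%N)%g.

End Frobenius2.

(* The element x + x ^ q of F_q for x in F_{q^2}, where q = 2 ^ n. *)
Fact add_conj_subproof n (x : GF two (2 * n)) :
  x + x ^+ (2 ^ n) \in @subGF_pred two (2 * n) n.
Proof.
rewrite inE (GF_expD (p := two)) -exprM -expnD addnn -mul2n.
by rewrite (GF_exp_card (p := two)) addrC.
Qed.
Definition add_conj n (x : GF two (2 * n)) : subGF two (2 * n) n :=
  SubGF (add_conj_subproof x).

Fact add_conjD n (x y : GF two (2 * n)) :
  add_conj (x + y) = add_conj x + add_conj y.
Proof. by apply: val_inj; rewrite /= (GF_expD (p := two)) addrACA. Qed.

Section FamilyB.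

Variables (n : nat) (e : GF two (2 * n)).
Implicit Types x y z : GF two (2 * n).

Definition B_cocycle x y : subGF two (2 * n) n :=
  add_conj (x * y ^+ (2 ^ n) * e).

Fact B_cocycleDl x y z : B_cocycle (x + y) z = B_cocycle x z + B_cocycle y z.
Proof. by rewrite -add_conjD /B_cocycle !mulrDl. Qed.
Fact B_cocycleDr x y z : B_cocycle x (y + z) = B_cocycle x y + B_cocycle x z.
Proof.
by rewrite -add_conjD /B_cocycle (GF_expD (p := two)) mulrDr mulrDl.
Qed.

Definition B_group : finGroupType :=
  cocycle_group (Biadditive B_cocycleDl B_cocycleDr).

End FamilyB.

Section FamilyP.

Variable e : GF two (2 * 3).
Implicit Types x y z : GF two (2 * 3).

Definition P_cocycle x y : subGF two (2 * 3) 3 :=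
  add_conj (n := 3) (x * y ^+ 2 * e).

Fact P_cocycleDl x y z : P_cocycle (x + y) z = P_cocycle x z + P_cocycle y z.
Proof. by rewrite -add_conjD /P_cocycle !mulrDl. Qed.
Fact P_cocycleDr x y z : P_cocycle x (y + z) = P_cocycle x y + P_cocycle x z.
Proof.
have E : (y + z) ^+ 2 = y ^+ 2 + z ^+ 2 by exact: (@GF_expD two _ 1).
by rewrite -add_conjD /P_cocycle E mulrDr mulrDl.
Qed.

Definition P_group : finGroupType :=
  cocycle_group (Biadditive P_cocycleDl P_cocycleDr).

End FamilyP.

(* The exterior square of F^d in the coordinates given by its standard basis
   e_i /\ e_j, i < j; see wedge_universal. *)
Definition ext2 (F : finFieldType) (d : nat) : Type :=
  {ffun {ij : 'I_d * 'I_d | (ij.1 < ij.2)%N} -> F^o}.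
HB.instance Definition _ F d := Finite.on (ext2 F d).
HB.instance Definition _ F d := GRing.Lmodule.on (ext2 F d).

Definition wedge (F : finFieldType) d (v w : 'rV[F]_d) : ext2 F d :=
  [ffun ij => let: (i, j) := val ij in v 0 i * w 0 j - v 0 j * w 0 i].

Section FamilyExt.

Variable F : finFieldType.
Implicit Types v w x : 'rV[F]_3.

Fact wedgeDl v w x : wedge (v + w) x = wedge v x + wedge w x.
Proof.
apply/ffunP=> -[[i j] ij]; rewrite !ffunE /= !mxE !mulrDl opprD.
by rewrite addrACA.
Qed.
Fact wedgeDr v w x : wedge v (w + x) = wedge v w + wedge v x.
Proof.
apply/ffunP=> -[[i j] ij]; rewrite !ffunE /= !mxE !mulrDr opprD.
by rewrite addrACA.
Qed.

Definition ext_group : finGroupType :=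
  cocycle_group (Biadditive wedgeDl wedgeDr).

End FamilyExt.

Lemma wedge_universal (F : finFieldType) (d : nat) (W : lmodType F)
    (g : {bilinear 'rV[F]_d -> 'rV[F]_d -> W}) :
  (forall v, g v v = 0) ->
  exists2 h : {linear ext2 F d -> W}, forall v w, h (wedge v w) = g v w
    & forall h' : {linear ext2 F d -> W},
        (forall v w, h' (wedge v w) = g v w) -> h' =1 h.
Proof.
move=> galt.
pose e (i : 'I_d) : 'rV[F]_d := delta_mx 0 i.
pose T := {ij : 'I_d * 'I_d | (ij.1 < ij.2)%N}.
pose h0 (x : ext2 F d) := \sum_(t : T) (x t : F) *: g (e (val t).1) (e (val t).2).
have h0lin : linear h0.
  move=> a x y; rewrite /h0 scaler_sumr -big_split; apply: eq_bigr => t _.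
  by rewrite !ffunE scalerA scalerDl.
pose hM := GRing.isLinear.Build _ _ _ _ h0 h0lin.
pose h : {linear ext2 F d -> W} := HB.pack h0 hM.
have gC v w : g w v = - g v w.
  have := galt (v + w); rewrite linearDl !linearDr !galt addr0 add0r.
  by move/eqP; rewrite addrC addr_eq0 => /eqP.
have gE v w : g v w = \sum_i \sum_j (v 0 i * w 0 j) *: g (e i) (e j).
  rewrite [in LHS](row_sum_delta v) linear_sumlz; apply: eq_bigr => i _.
  rewrite [in LHS](row_sum_delta w) linear_sumr; apply: eq_bigr => j _.
  by rewrite linearZl_LR linearZr_LR /= scalerA.
have hE v w : h (wedge v w) = g v w.
  pose H (ij : 'I_d * 'I_d) : W := (v 0 ij.1 * w 0 ij.2 - v 0 ij.2 * w 0 ij.1) *: g (e ij.1) (e ij.2).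
  have -> : h (wedge v w) = \sum_(ij : 'I_d * 'I_d | (ij.1 < ij.2)%N) H ij.
    rewrite (reindex_omap (val : T -> 'I_d * 'I_d) insub) => [|ij lt_ij]; last first.
      by rewrite insubT.
    apply: eq_big => [[[i j] ij]|[[i j] ij] _]; last by rewrite ffunE.
    by rewrite /= insubT /= eqxx andbT [RHS]ij.
  rewrite (gE v w) pair_big /= [RHS](bigID (fun ij : 'I_d * 'I_d => (ij.1 < ij.2)%N)) /=.
  rewrite [X in _ = _ + X](bigID (fun ij : 'I_d * 'I_d => ij.1 == ij.2)) /=.
  rewrite [X in _ = _ + (X + _)]big1 ?add0r; last first.
    by case=> i j /= /andP[_ /eqP->]; rewrite galt scaler0.
  rewrite [X in _ = _ + X](reindex_inj (can_inj swap_pairK)) /=.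
  rewrite [X in _ = _ + X](eq_bigl (fun ij : 'I_d * 'I_d => (ij.1 < ij.2)%N)); last first.
    by case=> i j /=; rewrite -leqNgt leq_eqVlt -val_eqE /= (eq_sym (j : nat));
       case: ltngtP.
  rewrite -big_split; apply: eq_bigr => -[i j] _ /=.
  by rewrite [g (e j) (e i)]gC scalerN -scalerBl.
exists h => // h' h'E x.
have -> : x = \sum_(t : T) (x t : F) *: wedge (e (val t).1) (e (val t).2).
  apply/ffunP=> -[[i j] ij]; rewrite sum_ffunE (bigD1 (exist _ (i, j) ij)) //=.
  have ijF : (j == i) = false by rewrite -val_eqE gtn_eqF.
  rewrite big1 => [|[[k l] kl] /= ne]; rewrite !ffunE /= !mxE !eqxx /=.
    by rewrite addr0 ijF mul0r subr0 mulr1 [RHS]mulr1.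
  rewrite -!natrM !mulnb.
  have -> : (i == k) && (j == l) = false.
    apply/negbTE; apply: contra ne => /andP[/eqP ik /eqP jl].
    by rewrite -val_eqE /= ik jl.
  have -> : (j == k) && (i == l) = false.
    apply/negbTE/negP => /andP[/eqP jk /eqP il].
    by have := kl; rewrite /= -jk -il ltnNge ltnW.
  by rewrite subrr [LHS]mulr0.
rewrite !linear_sum; apply: eq_bigr => t _.
by rewrite !linearZ h'E hE.
Qed.

Definition alternating (F : fieldType) (k : nat) (f : {biscalar 'rV[F]_k}) :=
  forall v, f v v = 0.
Definition nondegenerate_form (F : fieldType) (k : nat)
    (f : {biscalar 'rV[F]_k}) :=
  forall v, (forall w, f v w = 0) -> v = 0.

(* The field trace from F_{p^b} to F_{p^n}; see traceE for the link with
   galTrace. *)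
Section Trace.

Variables (p : prime_nat) (n b : nat) (nb : (n %| b)%N).
Implicit Types x y : GF p b.

Fact trace_subproof x :
  \sum_(i < (b %/ n)%N) x ^+ ((p ^ n) ^ i) \in @subGF_pred p b n.
Proof.
rewrite inE.
have -> : forall I (r : seq I) (E : I -> GF p b),
    (\sum_(i <- r) E i) ^+ (p ^ n) = \sum_(i <- r) E i ^+ (p ^ n).
  move=> I r E; elim: r => [|i r IHr]; first by rewrite !big_nil GF_exp0.
  by rewrite !big_cons GF_expD IHr.
under eq_bigr => i _ do rewrite -exprM -expnSr.
case E: (b %/ n)%N => [|m]; first by rewrite !big_ord0.
rewrite big_ord_recr [X in _ == X]big_ord_recl /= addrC.
apply/eqP; congr (_ + _); rewrite expn0 expr1 -E -expnM mulnC divnK //.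
exact: GF_exp_card.
Qed.
Definition trace x : subGF p b n := SubGF (trace_subproof x).

Fact traceD x y : trace (x + y) = trace x + trace y.
Proof.
apply: val_inj; rewrite /= -big_split; apply: eq_bigr => i _.
by rewrite -expnM GF_expD.
Qed.

End Trace.

Lemma galTrace_sum (F : finFieldType) (L : splittingFieldType F)
    (K : {subfield L}) (x : L) :
  galTrace K {:L} x = \sum_(i < \dim_K {:L}) x ^+ ((#|F| ^ \dim K) ^ i).
Proof.
have [a defG aE] := finField_galois_generator (subvf K).
have dimE : (\dim_K {:L} = #[a]%g)%N.
  rewrite (galois_dim (finField_galois (subvf K))) orderE.
  by move/eqP: defG => ->.
have aiE i : (a ^+ i)%g x = x ^+ ((#|F| ^ \dim K) ^ i).
  elim: i => [|i IH]; first by rewrite gal_id.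
  by rewrite expgSr galM ?memvf // IH aE ?memvf // -exprM -expnSr.
rewrite dimE /galTrace; transitivity (\sum_(f in <[a]>%g) f x).
  by apply: eq_bigl => f; move/eqP: defG => ->.
have -> : <[a]>%g = [set (a ^+ (i : 'I_(#[a]%g)))%g | i in [set: 'I_(#[a]%g)]].
  apply/setP=> f; apply/idP/imsetP => [/cyclePmin[i lt_i ->]|[i _ ->]].
    by exists (Ordinal lt_i).
  exact: mem_cycle.
rewrite big_imset /=; first by apply: eq_big => [i|i _]; rewrite ?inE ?aiE.
move=> i j _ _ /eqP; rewrite eq_expg_mod_order !modn_small ?ltn_ord // => /eqP.
exact: val_inj.
Qed.

Lemma traceE (p : prime_nat) (n b : nat) (nb : (n %| b)%N) (x : GF p b)
    (L := pPrimeCharType (GF_pchar p b)) (K : {subfield L}) :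
  (0 < b)%N -> \dim K = n -> subGF_val (trace nb x) = galTrace K {:L} x :> L.
Proof.
move=> b_gt0 dimK; rewrite galTrace_sum dimK card_Fp ?prime_pnat //.
have -> : \dim {:L} = b.
  by rewrite pprimeChar_dimf (card_GF p b_gt0) pfactorK ?prime_pnat.
by [].
Qed.

Section FamilyForm.

Variables (p : prime_nat) (n b k : nat) (nb : (n %| b)%N).
Variable f : {biscalar 'rV[GF p b]_k}.

Definition form_cocycle v w : subGF p b n := trace nb (f v w).

Fact form_cocycleDl v w x :
  form_cocycle (v + w) x = form_cocycle v x + form_cocycle w x.
Proof. by rewrite -traceD -linearDl. Qed.
Fact form_cocycleDr v w x :
  form_cocycle v (w + x) = form_cocycle v w + form_cocycle v x.
Proof. by rewrite -traceD -linearD. Qed.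

Definition form_group : finGroupType :=
  cocycle_group (Biadditive form_cocycleDl form_cocycleDr).

End FamilyForm.

(* The elements epsilon and the forms f fixed in the definitions of B(n), of P
   and of F_{p^n} : F_q^k, where q = p ^ b. *)
Record choices := Choices {
  epsB : forall n, GF two (2 * n);
  epsP : GF two (2 * 3);
  form : forall (p : prime_nat) (b k : nat), {biscalar 'rV[GF p b]_k};
  epsB_order : forall n, (0 < n)%N -> (2 ^ n).+1.-primitive_root (epsB n);
  epsP_order : 63.-primitive_root epsP;
  form_alternating : forall (p : prime_nat) (b k : nat),
    odd p -> (0 < b)%N -> ~~ odd k -> alternating (form p b k);
  form_nondegenerate : forall (p : prime_nat) (b k : nat),
    odd p -> (0 < b)%N -> ~~ odd k -> nondegenerate_form (form p b k) }.

Lemma exists_primitive_root (F : finFieldType) (k : nat) :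
  (k %| #|F|.-1)%N -> exists z : F, k.-primitive_root z.
Proof.
move=> kN; have /cyclicP[u defG] := field_unit_group_cyclic [set: {unit F}].
have ou : #[u]%g = #|F|.-1 by rewrite orderE -defG card_finField_unit.
have Fu : (#|F|.-1).-primitive_root (val u).
  have N_gt0 : (0 < #|F|.-1)%N by rewrite -ou order_gt0.
  apply/andP; split=> //; apply/forallP=> i; rewrite unity_rootE -val_unitX.
  rewrite -[1](val_unit1 F) val_eqE -order_dvdn ou; apply/eqP.
  apply/idP/eqP => [/dvdn_leq le|->//]; apply/eqP.
  by rewrite eqn_leq ltn_ord le.
by exists (val u ^+ (#|F|.-1 %/ k)); apply: dvdn_prim_root.
Qed.

Section StandardForm.

Variables (F : fieldType) (k : nat).
Implicit Types v w x : 'rV[F]_k.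

Definition std_sign (i : 'I_k) : F := if (i < k./2)%N then 1 else -1.
Definition std_form v w := \sum_i std_sign i * (v 0 i * w 0 (rev_ord i)).

Fact std_form_bilinear : bilinear_for *%R *%R std_form.
Proof.
split=> u a v w; rewrite /std_form /= mulr_sumr -big_split; apply: eq_bigr => i _;
  rewrite /= !mxE.
- by rewrite mulrDl mulrDr -mulrA (mulrCA (std_sign i) a).
- by rewrite !mulrDr (mulrCA (u 0 i) a) (mulrCA (std_sign i) a).
Qed.
HB.instance Definition _ := bilinear_isBilinear.Build F 'rV[F]_k 'rV[F]_k F
  *%R *%R std_form std_form_bilinear.

Lemma std_form_nondegenerate : nondegenerate_form (std_form : {biscalar 'rV[F]_k}).
Proof.
move=> v v0; apply/rowP=> i; rewrite mxE.
have : std_form v (delta_mx 0 (rev_ord i)) = 0 by exact: v0.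
rewrite /std_form (bigD1 i) //=.
rewrite big1 => [|j ji].
  rewrite mxE !eqxx addr0 mulr1 /std_sign; case: ifP => _; rewrite ?mul1r //.
  by rewrite mulN1r => /eqP; rewrite oppr_eq0 => /eqP.
by rewrite mxE eqxx (inj_eq rev_ord_inj) (negbTE ji) !mulr0.
Qed.

Lemma std_form_alternating : (2%:R != 0 :> F) -> ~~ odd k ->
  alternating (std_form : {biscalar 'rV[F]_k}).
Proof.
move=> F2 ek v; have E : std_form v v = - std_form v v.
  rewrite [LHS](reindex_inj rev_ord_inj) /= -sumrN; apply: eq_bigr => i _.
  rewrite rev_ordK -mulNr [v 0 i * _]mulrC; congr (_ * _).
  have kE : k = (k./2 + k./2)%N by rewrite addnn -[LHS]odd_double_half (negbTE ek).
  have := ltn_ord i; rewrite /std_sign /= => ik.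
  have -> : (k - i.+1 < k./2)%N = ~~ (i < k./2)%N.
    by rewrite ltn_subLR // {1}kE ltn_add2r ltnS leqNgt.
  by case: (i < _)%N; rewrite //= opprK.
apply/eqP; move/eqP: E; rewrite -addr_eq0 -mulr2n -mulr_natl mulf_eq0.
by rewrite (negbTE F2).
Qed.

End StandardForm.

Lemma choices_inhabited : inhabited choices.
Proof.
have eB n : {e : GF two (2 * n) | (0 < n)%N ==> (2 ^ n).+1.-primitive_root e}.
  apply: sigW; case: (posnP n) => [->|n_gt0]; first by exists 0.
  apply: exists_primitive_root; rewrite card_GF ?muln_gt0 //= mulnC expnM.
  by rewrite -subn1 -(exp1n 2) subn_sqr exp1n addn1 dvdn_mull.
have [eP eP1] : {e : GF two (2 * 3) | 63.-primitive_root e}.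
  by apply: sigW; apply: exists_primitive_root; rewrite card_GF.
constructor; exists (fun n => sval (eB n)) eP
  (fun p b k => @std_form (GF p b) k : {biscalar 'rV[GF p b]_k}) => //.
- by move=> n; apply/implyP; exact: svalP (eB n).
- move=> p b k podd b_gt0; apply: std_form_alternating.
  rewrite -(dvdn_pcharf (GF_pchar p b)) gtnNdvd //.
  by rewrite odd_gt2 ?prime_gt1 ?prime_pnat.
by move=> p b k _ _ _; apply: std_form_nondegenerate.
Qed.

Inductive in_families (c : choices) : finGroupType -> Prop :=
| Family1 (p : prime_nat) (n : nat) :
    (0 < n)%N -> in_families c (homocyclic_p2 p n)
| Family2 (p r : prime_nat) (d : nat) :
    p != r -> r.-1.-primitive_root (p%:R : 'F_r) -> (0 < d)%N ->
    in_families c (affine_group (GF p r.-1) r d)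
| Family3 (n : nat) (theta : [subg field_Aut (GF two n)]) :
    (0 < n)%N -> (forall k, n <> 2 ^ k)%N ->
    odd #[theta]%g -> (1 < #[theta]%g)%N ->
    in_families c (A_group theta)
| Family4 (n : nat) :
    (0 < n)%N -> in_families c (B_group (epsB c n))
| Family5 : in_families c (P_group (epsP c))
| Family6 (p : prime_nat) (k : nat) :
    odd p -> (0 < k)%N -> in_families c (ext_group (GF p k))
| Family7 (p : prime_nat) (n b m : nat) (nb : (n %| b)%N) :
    odd p -> (0 < m)%N -> (b %| m)%N -> ~~ odd (m %/ b) ->
    in_families c (form_group nb (form c p b (m %/ b))).

(* The parameters of the restricted list: List3 n i stands for A(n, phi ^ i)
   and List7 p n m for F_{p^n} : F_{p^n}^{m/n}, whose trace is the identity. *)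
Inductive label : Type :=
| List1 (p : prime_nat) (n : nat)
| List2 (p r : prime_nat) (d : nat)
| List3 (n i : nat)
| List4 (n : nat)
| List5
| List6 (p : prime_nat) (k : nat)
| List7 (p : prime_nat) (n m : nat).

Definition listed (l : label) : Prop :=
  match l with
  | List1 p n => (0 < n)%N
  | List2 p r d =>
      [/\ p != r, r.-1.-primitive_root (p%:R : 'F_r) & (0 < d)%N]
  | List3 n i =>
      [/\ (0 < n)%N, (forall k, n <> 2 ^ k)%N
        & (1 <= i <= (n`_2^' - 1) %/ 2)%N]
  | List4 n => (0 < n)%N
  | List5 => True
  | List6 p k => odd p /\ (0 < k)%N
  | List7 p n m => [/\ odd p, (0 < m)%N, (n %| m)%N & ~~ odd (m %/ n)]
  end.

Definition list_group (c : choices) (l : label) : finGroupType :=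
  match l with
  | List1 p n => homocyclic_p2 p n
  | List2 p r d => affine_group (GF p r.-1) r d
  | List3 n i => A_group (phi n ^+ i)%g
  | List4 n => B_group (epsB c n)
  | List5 => P_group (epsP c)
  | List6 p k => ext_group (GF p k)
  | List7 p n m => form_group (dvdnn n) (form c p n (m %/ n))
  end.

(* Main.v *)
From HB Require Import structures.
Require Import Defs.
From mathcomp Require Import all_boot all_order all_algebra all_fingroup.
From mathcomp Require Import all_solvable all_field ring zify.

(** The homocyclic groups and the affine groups are treated directly.  All the
    other groups are central extensions of a finite additive group U by a finite
    additive group V: the set U * V with its product twisted by a biadditive map
    b : U -> U -> V.

    Three orbits.  When the commutator form b u w - b w u is nondegenerate, the
    centre is 0 * V, so that 1, the other central elements and the noncentral
    elements are never fused.  By three_orbit_cocycle there is nothing else to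
    separate elements as soon as similitudes of b, that is, pairs (al, be) with
    b (al u) (al w) = be (b u w), are transitive on the nonzero elements of U and
    on those of V, and enough additive maps U -> V exist.  The similitudes are
    multiplications by field elements for A(n, theta), B(n) and P, with a
    semilinear map in addition for P; the action of GL_3 on vectors and bivectors
    for the exterior square; and symplectic transvections, together with scalings
    of a Lagrangian subspace, for symplectic forms.

    Distinctness.  The order and the order of the centre tell the listed groups
    apart except A(n, phi^i) from A(n, phi^j), and P from B(3).  In both cases an
    isomorphism induces additive bijections al and be that carry one squaring map
    U -> V to the other, and these maps are x |-> x^(1 + 2^s) up to constants and a
    trace.  Additive maps of the field with 2^n elements are linearized
    polynomials, with terms a_k x^(2^k), so one can compare coefficients:
    gold_exponent shows that the exponents s and t of two maps related in this way
    satisfy t = s or t = - s modulo n.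

    Redundancy.  Field automorphisms are powers of the Frobenius map, and
    A(n, theta) is isomorphic to A(n, theta^-1).  The trace of a nondegenerate
    alternating form is a nondegenerate alternating form over the subfield, and
    all such forms of a given dimension are equivalent to the standard one, by
    symplectic_basis; hence the groups built from forms depend only on p, n and m. *)

Set Implicit Arguments.
Unset Strict Implicit.
Unset Printing Implicit Defensive.

Import GRing.Theory FinRing.Theory.
Local Open Scope ring_scope.

(** * Automorphism orbits *)

Lemma morph0 (U V : zmodType) (f : U -> V) : {morph f : x y / x + y} -> f 0 = 0.
Proof. by move=> fD; apply: (addrI (f 0)); rewrite -fD !addr0. Qed.

Lemma bij_isog (G H : finGroupType) (f : G -> H) :
  {morph f : x y / (x * y)%g} -> bijective f -> [set: G] \isog [set: H].
Proof.
move=> fM fB; apply/isogP; exists (@Morphism _ _ [set: G] f (in2W fM)).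
  by apply/injmP=> x y _ _ /(bij_inj fB).
rewrite /= morphimEdom; apply/setP=> y; rewrite inE; apply/imsetP.
by have [g fK gK] := fB; exists (g y); rewrite ?inE.
Qed.

Lemma isog_bij (G H : finGroupType) : [set: G] \isog [set: H] ->
  exists2 f : G -> H, {morph f : x y / (x * y)%g} & bijective f.
Proof.
move=> isoGH; have /isogP[f /injmP f_inj _] := isoGH.
exists f => [x y|]; first by rewrite morphM ?inE.
apply: inj_card_bij => [x y /f_inj-> //|]; rewrite ?inE //.
by have:= card_isog isoGH; rewrite !cardsT => ->.
Qed.

(** Membership in one orbit of Aut G, with the automorphism given as a bare
    function, which spares building permutations of the concrete groups. *)
Definition fused (G : finGroupType) (x y : G) :=
  exists f : G -> G,
    [/\ {morph f : u v / (u * v)%g}, injective f & f x = y].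

Lemma orbit_AutP (G : finGroupType) (x y : G) :
  y \in orbit 'P (Aut [set: G]) x <-> fused x y.
Proof.
split=> [/orbitP[a aG <-]|[f [fM f_inj <-]]].
  exists a; split=> // [u v|]; last exact: perm_inj.
  by have := aG; rewrite inE => /andP[_ /morphicP]; apply; rewrite inE.
apply/orbitP; exists (perm f_inj); last by rewrite /= /aperm permE.
rewrite inE; apply/andP; split; first by apply/subsetP=> z; rewrite !inE.
by apply/morphicP=> u v _ _; rewrite !permE fM.
Qed.

Lemma fused_orbit (G : finGroupType) (x y : G) : fused x y <->
  orbit 'P (Aut [set: G]) x = orbit 'P (Aut [set: G]) y.
Proof.
split=> [/orbit_AutP/orbit_eqP-> // | xy].
by apply/orbit_AutP; rewrite xy orbit_refl.
Qed.

Lemma fused_trans (G : finGroupType) (y x z : G) :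
  fused x y -> fused y z -> fused x z.
Proof. by move=> /fused_orbit xy /fused_orbit yz; apply/fused_orbit; rewrite xy. Qed.

Lemma fused1 (G : finGroupType) (x : G) : fused 1%g x -> x = 1%g.
Proof.
by case=> f [fM _ <-]; apply: (mulIg (f 1%g)); rewrite -fM !mul1g.
Qed.

Lemma fused_expg1 (G : finGroupType) (x y : G) k :
  fused x y -> (x ^+ k)%g = 1%g -> (y ^+ k)%g = 1%g.
Proof.
case=> f [fM f_inj <-] xk; have f1 : f 1%g = 1%g.
  by apply: fused1; exists f.
have fX j : f (x ^+ j)%g = (f x ^+ j)%g.
  by elim: j => [|j IH]; rewrite ?expg0 // !expgS fM IH.
by rewrite -fX xk f1.
Qed.

(** The orbits are 1, Z minus 1 and the complement of Z; z0 and x0 witness that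
    the last two are not empty. *)
Lemma three_orbit_of_fused (G : finGroupType) (Z : {pred G}) (z0 x0 : G) :
    z0 \in Z -> z0 != 1%g -> x0 \notin Z -> 1%g \in Z ->
    (forall x y, fused x y -> x \in Z -> y \in Z) ->
    (forall x y, x \in Z -> y \in Z -> x != 1%g -> y != 1%g -> fused x y) ->
    (forall x y, x \notin Z -> y \notin Z -> fused x y) ->
  three_orbit G.
Proof.
move=> Zz0 z0n1 Zx0 Z1 Zinv Zfuse Gfuse.
pose O x := orbit 'P (Aut [set: G]) x.
have Oneq x y : ~ fused x y -> O x != O y.
  by move=> nxy; apply/eqP=> /fused_orbit.
have n1z : ~ fused 1%g z0 by move/fused1/eqP; rewrite (negbTE z0n1).
have n1x : ~ fused 1%g x0 by move/fused1=> x01; rewrite x01 Z1 in Zx0.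
have nzx : ~ fused z0 x0 by move/Zinv/(_ Zz0); rewrite (negbTE Zx0).
rewrite /three_orbit.
have -> : [set O x | x in [set: G]] = [set:: [:: O 1%g; O z0; O x0]].
  apply/setP=> X; rewrite inE; apply/imsetP/idP => [[x _ ->]|].
    rewrite !inE; have [->|xn1] := eqVneq x 1%g; first by rewrite eqxx.
    have [Zx|Zx] := boolP (x \in Z); apply/or3P.
      by apply: Or32; apply/eqP/fused_orbit/Zfuse.
    by apply: Or33; apply/eqP/fused_orbit/Gfuse.
  by rewrite !inE => /or3P[]/eqP->; [exists 1%g | exists z0 | exists x0].
rewrite cardsE; apply/card_uniqP.
by rewrite /= !inE negb_or !Oneq.
Qed.

Lemma three_orbit_isog (G H : finGroupType) :
  [set: G] \isog [set: H] -> three_orbit H -> three_orbit G.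
Proof.
move=> isoGH; have [f fM [g fK gK]] := isog_bij isoGH.
have gM : {morph g : x y / (x * y)%g}.
  by move=> x y; apply: (can_inj fK); rewrite fM !gK.
have trans (K L : finGroupType) (h : K -> L) (h' : L -> K) :
    {morph h : x y / (x * y)%g} -> {morph h' : x y / (x * y)%g} ->
    cancel h h' -> cancel h' h -> forall x y, fused x y -> fused (h x) (h y).
  move=> hM h'M hK h'K x y [a [aM a_inj <-]].
  exists (h \o a \o h'); split=> [u v||] /=; first by rewrite h'M aM hM.
    exact: inj_comp (inj_comp (can_inj hK) a_inj) (can_inj h'K).
  by rewrite hK.
rewrite /three_orbit => <-.
rewrite -(card_imset _ (imset_inj (can_inj fK))); apply: eq_card => X.
suff orbitM x : f @: orbit 'P (Aut [set: G]) x = orbit 'P (Aut [set: H]) (f x).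
  apply/imsetP/imsetP=> [[_ /imsetP[x _ ->] ->]|[y _ ->]].
    by exists (f x); rewrite ?inE.
  exists (orbit 'P (Aut [set: G]) (g y)); first by rewrite imset_f ?inE.
  by rewrite orbitM gK.
apply/setP=> y; apply/imsetP/idP => [[z /orbit_AutP xz ->]|/orbit_AutP fxy].
  by apply/orbit_AutP; apply: (trans _ _ f g).
exists (g y); rewrite ?gK //; apply/orbit_AutP.
by rewrite -[x]fK; apply: (trans _ _ g f).
Qed.

(** * Central extensions by biadditive cocycles *)

Section CocycleGroups.

Variables (U V : finZmodType) (b : biadditive U V).
Local Notation G := (cocycle_group b).

Lemma cocycleM (x y : G) : (x * y)%g = (x.1 + y.1, x.2 + y.2 + b x.1 y.1) :> G.
Proof. by []. Qed.

Lemma bfun0r x : b x 0 = 0.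
Proof. by apply: (addrI (b x 0)); rewrite -bfunDr !addr0. Qed.

Lemma card_cocycle_group : #|[set: G]| = (#|U| * #|V|)%N.
Proof. by rewrite cardsT; exact: card_prod. Qed.

(** The commutator of (u, _) and (w, _) has second coordinate b u w - b w u, so
    this says that no element outside 0 * V is central. *)
Definition commutator_nondegenerate :=
  forall u, (forall w, b u w = b w u) -> u = 0.

Hypothesis b_nondeg : commutator_nondegenerate.

Lemma cocycle_centerE (x : G) : (x \in 'Z([set: G])%g) = (x.1 == 0).
Proof.
apply/centerP/eqP=> [[_ xC]|x0].
  apply: b_nondeg => w; have /(congr1 snd) := xC (w, 0) (in_setT _).
  by rewrite /= addr0 add0r => /addrI.
split=> [|y _]; first by rewrite inE.
rewrite /commute !cocycleM x0 bfun0l bfun0r !addr0 add0r.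
by congr (_, _); exact: addrC.
Qed.

Lemma card_cocycle_center : #|'Z([set: G])%g| = #|V|.
Proof.
have inj0 : injective (fun v : V => (0, v) : G) by move=> v v' [].
rewrite -(card_imset predT inj0); apply: eq_card => x.
rewrite cocycle_centerE; apply/eqP/imsetP=> [x0|[v _ ->] //].
by exists x.2 => //; rewrite -x0; case: x {x0}.
Qed.

End CocycleGroups.

Section CocycleMorphisms.

Variables (U V U' V' : finZmodType) (b : biadditive U V) (b' : biadditive U' V').

(** An isomorphism must act on the quotient U and on the centre V; the map h
    accounts for the choice of a section, and changes the cocycle by a
    coboundary. *)
Definition shear (al : U -> U') (be : V -> V') (h : U -> V')
  (x : cocycle_group b) : cocycle_group b' := (al x.1, be x.2 + h x.1).

Lemma shearM al be h :
    {morph al : x y / x + y} -> {morph be : x y / x + y} ->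
    (forall x y, b' (al x) (al y) + (h x + h y) = be (b x y) + h (x + y)) ->
  {morph shear al be h : x y / (x * y)%g}.
Proof.
move=> alD beD hE x y; rewrite !cocycleM; congr (_, _); rewrite /= ?alD //.
by rewrite !beD -[LHS]addrA -hE [in RHS]addrACA [RHS]addrAC -[RHS]addrA.
Qed.

Lemma shear_inj al be h : injective al -> injective be ->
  injective (shear al be h).
Proof.
move=> al_inj be_inj [u v] [u' v'] [/= /al_inj <- /addIr/be_inj ->] //.
Qed.

Lemma cocycle_isog al be h :
    {morph al : x y / x + y} -> {morph be : x y / x + y} ->
    injective al -> injective be -> #|U'| = #|U| -> #|V'| = #|V| ->
    (forall x y, b' (al x) (al y) + (h x + h y) = be (b x y) + h (x + y)) ->
  [set: cocycle_group b] \isog [set: cocycle_group b'].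
Proof.
move=> alD beD al_inj be_inj cU cV hE.
apply: bij_isog (shearM alD beD hE) _.
apply: inj_card_bij; first exact: shear_inj.
by rewrite -!cardsT !card_cocycle_group cU cV.
Qed.

(** An isomorphism respects centres, hence induces al on the quotients and be on
    the centres.  In characteristic 2 the square of (u, v) is (0, b u u), which
    depends on u alone, so al and be intertwine the squaring maps. *)
Lemma cocycle_isog_square :
    commutator_nondegenerate b -> commutator_nondegenerate b' ->
    (forall u : U, u + u = 0) -> (forall u : U', u + u = 0) ->
    (forall v : V', v + v = 0) ->
    [set: cocycle_group b] \isog [set: cocycle_group b'] ->
  exists al : U -> U', exists be : V -> V',
   [/\ {morph al : x y / x + y}, {morph be : x y / x + y}, injective al,
       injective be & forall u, be (b u u) = b' (al u) (al u)].
Proof.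
move=> bN b'N U2 U'2 V'2 isoG; have [f fM [g fK gK]] := isog_bij isoG.
pose G := cocycle_group b; pose G' := cocycle_group b'.
have fZ (x : G) : ((f x).1 == 0) = (x.1 == 0).
  rewrite -!cocycle_centerE //.
  apply/centerP/centerP=> -[_ xC]; split=> [|y _]; rewrite ?inE //.
    by apply: (can_inj fK); rewrite !fM; apply: xC; rewrite inE.
  by rewrite /commute -[y]gK -!fM; congr f; apply: xC; rewrite inE.
pose al u := (f (u, 0)).1; pose be v := (f (0, v)).2.
have fE u v : f (u, v) = ((f (u, 0) : G') * f (0, v))%g.
  by rewrite -fM cocycleM /= bfun0r !addr0 add0r.
have f0 v : f (0, v) = (0, be v).
  by rewrite [LHS]surjective_pairing; congr (_, _); apply/eqP; rewrite fZ.
have fuv u v : (f (u, v)).1 = al u by rewrite fE f0 /= addr0.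
exists al, be; split.
- move=> u u'; have := fM (u, 0) (u', 0).
  by move/(congr1 fst); rewrite [LHS]fuv.
- move=> v v'; have := fM (0, v) (0, v'); rewrite cocycleM /= addr0 !bfun0r addr0.
  by move/(congr1 snd); rewrite !f0 /= bfun0r addr0.
- move=> u u' /eqP; rewrite -subr_eq0 => al0.
  have : (((f (u, 0) : G') * f (- u', 0))%g).1 == 0.
    have -> : - u' = u' by apply/eqP; rewrite eq_sym -addr_eq0 U2.
    have := al0; rewrite /= -/(al u) -/(al u').
    by rewrite -[- al u']add0r -(U'2 (al u')) addrK.
  by rewrite -fM fZ /= subr_eq0 => /eqP.
- move=> v v' bev; have : f (0, v) = f (0, v') by rewrite !f0 bev.
  by move/(can_inj fK) => -[].
move=> u; have := fM (u, 0) (u, 0); rewrite !cocycleM /= U2 !add0r.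
by move/(congr1 snd); rewrite f0 /= V'2 add0r.
Qed.

End CocycleMorphisms.

Definition similitude (U V : finZmodType) (b : biadditive U V)
    (al : U -> U) (be : V -> V) :=
  [/\ {morph al : x y / x + y}, {morph be : x y / x + y}, injective al,
      injective be & forall x y, b (al x) (al y) = be (b x y)].

(** The centre 0 * V is characteristic.  Outside it, a similitude first takes the
    quotient coordinate u to u'; the automorphism (u, v) |-> (u, v + h u) then
    adjusts the central coordinate, which can take any value since h u' can. *)
Lemma three_orbit_cocycle (U V : finZmodType) (b : biadditive U V)
    (u0 : U) (v0 : V) :
    u0 != 0 -> v0 != 0 -> commutator_nondegenerate b ->
    (forall u u', u != 0 -> u' != 0 ->
      exists al, exists2 be, similitude b al be & al u = u') ->
    (forall v v', v != 0 -> v' != 0 ->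
      exists al, exists2 be, similitude b al be & be v = v') ->
    (forall u w, u != 0 ->
      exists2 h : U -> V, {morph h : x y / x + y} & h u = w) ->
  three_orbit (cocycle_group b).
Proof.
move=> u0n0 v0n0 bN transU transV homUV; pose G := cocycle_group b.
apply: (@three_orbit_of_fused G [pred x : G | x.1 == 0] (0, v0) (u0, 0)); rewrite ?inE //=.
- by apply: contraNneq v0n0 => -[->].
- move=> x _ [f [fM f_inj <-]]; rewrite !inE -!cocycle_centerE //.
  move=> /centerP[_ xC]; apply/centerP.
  have [g fK gK] := injF_bij f_inj; split=> [|y _]; rewrite ?inE //.
  by rewrite /commute -[y]gK -!fM; congr f; apply: xC; rewrite inE.
- move=> [u v] [u' v']; rewrite !inE => /eqP/= -> /eqP/= ->.
  move=> vn1 v'n1.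
  have [||al [be [alD beD al_inj be_inj E] beE]] := transV v v'.
  - by apply: contraNneq vn1 => ->.
  - by apply: contraNneq v'n1 => ->.
  exists (@shear _ _ _ _ b b al be (fun=> 0)); split.
  - by apply: shearM => // x y; rewrite E !addr0.
  - exact: shear_inj.
  rewrite /shear /= beE addr0; congr (_, _).
  exact: morph0.
move=> [u v] [u' v']; rewrite !inE /= => un0 u'n0.
have [al [be [alD beD al_inj be_inj E] alE]] := transU u u' un0 u'n0.
have [h hD hE] := homUV u (v' - be v) un0.
exists (@shear _ _ _ _ b b al be h); split.
- by apply: shearM => // x y; rewrite E hD.
- exact: shear_inj.
by rewrite /shear /= alE hE addrC subrK.
Qed.

(** * Additive maps of a finite field as linearized polynomials *)

Section LinearizedPolynomials.

Variables (K : finFieldType) (p m : nat).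
Hypotheses (pcharK : p \in [pchar K]) (cardK : #|K| = (p ^ m.+1)%N).

Let p_gt1 : (1 < p)%N.
Proof. by rewrite prime_gt1 // (pcharf_prime pcharK). Qed.

Lemma frobeniusD k (x y : K) : (x + y) ^+ (p ^ k) = x ^+ (p ^ k) + y ^+ (p ^ k).
Proof.
by apply: exprDn_pchar; rewrite (eq_pnat _ (pcharf_eq pcharK)) pnatX pnat_id
  ?(pcharf_prime pcharK).
Qed.

(** The polynomial has degree at most p^m, too small to vanish at all the
    p^(m+1) elements of K. *)
Lemma linearized_eq0 (a : 'I_m.+1 -> K) :
  (forall x, \sum_k a k * x ^+ (p ^ k) = 0) -> forall k, a k = 0.
Proof.
move=> a0; pose P := \sum_k a k *: 'X^(p ^ k).
suff P0 : P = 0.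
  move=> k; have := congr1 (fun Q : {poly K} => Q`_(p ^ k)) P0.
  rewrite coef0 coef_sum (bigD1 k) //= coefZ coefXn eqxx mulr1.
  rewrite big1 ?addr0 // => j jk; rewrite coefZ coefXn eqn_exp2l //.
  by rewrite val_eqE eq_sym (negbTE jk) mulr0.
apply/eqP; apply: contraT => Pn0.
have : (size (enum K) < size P)%N.
  apply: max_poly_roots => //; last exact: enum_uniq.
  apply/allP=> x _; rewrite /root horner_sum -[X in _ == X](a0 x).
  by apply/eqP/eq_bigr => k _; rewrite hornerZ hornerXn.
rewrite -cardE cardK => szP.
have : (size P <= (p ^ m).+1)%N.
  apply: leq_trans (size_sum _ _ _) _; apply/bigmax_leqP => k _.
  apply: leq_trans (size_scale_leq _ _) _; rewrite size_polyXn ltnS.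
  by rewrite leq_exp2l // -ltnS.
by move/(leq_trans szP); rewrite ltnS leq_exp2l // ltnn.
Qed.

Lemma pchar_generators : exists b : 'I_m.+1 -> K,
  forall x, exists c : 'I_m.+1 -> nat, x = \sum_i b i *+ c i.
Proof.
pose L := pPrimeCharType pcharK.
have dimL : \dim {:L} = m.+1.
  by rewrite pprimeChar_dimf cardK pfactorK ?(pcharf_prime pcharK).
exists (fun i => (vbasis {:L})`_i) => x.
pose c (i : 'I_m.+1) : nat := coord (vbasis {:L}) (cast_ord (esym dimL) i) x.
exists c; have := coord_vbasis (memvf (x : L)).
rewrite (reindex (cast_ord (esym dimL))) /=; last first.
  by exists (cast_ord dimL) => i _; rewrite (cast_ordK, cast_ordKV).
move=> xE; rewrite [LHS]xE; apply: eq_bigr => i _; rewrite -/(c i).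
by rewrite -[X in X *: _]natr_Zp -/(c i) scaler_nat.
Qed.

(** Linearized polynomials give |K|^(m+1) distinct additive maps by
    linearized_eq0, and there are no more, since an additive map is determined
    by its values at m+1 generators. *)
Lemma linearized_surj (f : K -> K) : {morph f : x y / x + y} ->
  exists a : 'I_m.+1 -> K, forall x, f x = \sum_k a k * x ^+ (p ^ k).
Proof.
have [b bgen] := pchar_generators.
have ext (g g' : K -> K) : {morph g : x y / x + y} ->
    {morph g' : x y / x + y} -> (forall i, g (b i) = g' (b i)) -> g =1 g'.
  move=> gD g'D gg' x; have [c ->] := bgen x.
  have mn (h : K -> K) y k : {morph h : x y / x + y} -> h (y *+ k) = h y *+ k.
    by move=> hD; elim: k => [|k IH]; rewrite ?morph0 // !mulrS hD IH.
  rewrite (big_morph g gD (morph0 gD)) (big_morph g' g'D (morph0 g'D)).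
  by apply: eq_bigr => i _; rewrite !mn // gg'.
pose lin (a : {ffun 'I_m.+1 -> K}) x := \sum_k a k * x ^+ (p ^ k).
have linD a : {morph lin a : x y / x + y}.
  move=> x y; rewrite /lin -big_split; apply: eq_bigr => k _.
  by rewrite frobeniusD mulrDr.
pose Phi a := [ffun i => lin a (b i)].
have Phi_inj : injective Phi.
  move=> a a' aa'; apply/ffunP=> k; apply/eqP; rewrite -subr_eq0; apply/eqP.
  apply: (linearized_eq0 (a := fun k => a k - a' k)) => x.
  under eq_bigr do rewrite mulrBl; rewrite sumrB.
  apply/eqP; rewrite subr_eq0; apply/eqP/(ext _ _ (linD a) (linD a')) => i.
  by have := congr1 (fun h : {ffun _ -> _} => h i) aa'; rewrite !ffunE.
have [Psi _ PhiK] := injF_bij Phi_inj.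
move=> fD; exists (Psi [ffun i => f (b i)]) => x.
apply: (ext f _ fD (linD _)) => i.
have := congr1 (fun h : {ffun _ -> _} => h i) (PhiK [ffun i => f (b i)]).
by rewrite !ffunE.
Qed.

(** Comparing the coefficients of both sides of f (c x) = f c * f x gives
    a_k c^(p^k) = f c * a_k, so any one nonzero coefficient determines f. *)
Lemma field_morph_frobenius (f : K -> K) :
    {morph f : x y / x + y} -> {morph f : x y / x * y} -> injective f ->
  exists k : 'I_m.+1, forall x, f x = x ^+ (p ^ k).
Proof.
move=> fD fM f_inj; have [a aE] := linearized_surj fD.
have [k ak | a0] := pickP (fun k => a k != 0); last first.
  have f0 x : f x = 0.
    by rewrite aE big1 // => k _; have/eqP-> := negbFE (a0 k); rewrite mul0r.
  by have /eqP := f_inj 1 0 (etrans (f0 1) (esym (f0 0))); rewrite oner_eq0.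
exists k => c.
have /(_ k)/eqP : forall j, a j * c ^+ (p ^ j) - f c * a j = 0.
  apply: linearized_eq0 => x; under eq_bigr do rewrite mulrBl; rewrite sumrB.
  apply/eqP; rewrite subr_eq0; apply/eqP.
  transitivity (f (c * x)); last first.
    by rewrite fM [f x]aE mulr_sumr; apply: eq_bigr => j _; rewrite mulrA.
  by rewrite aE; apply: eq_bigr => j _; rewrite exprMn mulrA.
by rewrite mulrC -mulrBl mulf_eq0 (negbTE ak) orbF subr_eq0 => /eqP.
Qed.

End LinearizedPolynomials.

(** * Quadratic maps in characteristic 2 *)

Section QuadraticCoefficients.

Variables (K : finFieldType) (m : nat).
Hypotheses (char2 : 2%N \in [pchar K]) (cardK : #|K| = (2 ^ m.+1)%N).
Local Notation I := 'I_m.+1.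
Implicit Types (x y : K) (k l s t : I).
Local Notation fr k x := (x ^+ (2 ^ k%N)).

Lemma frobenius_mod x (j : nat) : x ^+ (2 ^ (j %% m.+1)) = x ^+ (2 ^ j).
Proof.
rewrite [in RHS](divn_eq j m.+1) expnD exprM; congr (_ ^+ _).
elim: (j %/ m.+1)%N => [|i IH]; first by rewrite mul0n expr1.
by rewrite mulSn expnD exprM -cardK expf_card.
Qed.

Lemma frobenius_addI k l x : fr (k + l)%R x = fr l (fr k x).
Proof. by rewrite frobenius_mod expnD exprM. Qed.

(** Polarizing and using linear independence in each of the two variables gives
    the relations off the diagonal.  The terms off the diagonal then cancel in
    pairs, which leaves the linearized polynomial with terms M k k x^(2^(k+1)). *)
Lemma quadratic_eq0 (M : I -> I -> K) :
    (forall x, \sum_k \sum_l M k l * (fr k x * fr l x) = 0) ->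
  (forall k l, M k l + M l k = 0) /\ (forall k, M k k = 0).
Proof.
move=> M0; pose B x y := \sum_k \sum_l M k l * (fr k x * fr l y).
have Malt k l : M k l + M l k = 0.
  have BE x y : \sum_k (\sum_l (M k l + M l k) * fr l y) * fr k x = 0.
    transitivity (B x y + B y x).
      rewrite /B [X in _ + X]exchange_big -big_split; apply: eq_bigr => i _ /=.
      rewrite mulr_suml -big_split; apply: eq_bigr => j _ /=.
      by rewrite !mulrDl; congr (_ + _); rewrite -mulrA; congr (_ * _); rewrite mulrC.
    (* both sides are the polar form of the quadratic map, M0 at x + y, x, y *)
    have := M0 (x + y); rewrite -[RHS](M0 x) => /eqP; rewrite eq_sym -subr_eq0.
    rewrite -[in X in X -> _](addr0 (\sum_k _)) -[X in _ + X - _](M0 y).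
    rewrite -oppr_eq0 opprB => /eqP <-; rewrite /B -!big_split -sumrB.
    apply: eq_bigr => i _ /=; rewrite -!big_split -sumrB.
    apply: eq_bigr => j _ /=; rewrite !(frobeniusD char2).
    ring.
  apply: (linearized_eq0 char2 cardK (a := fun l => M k l + M l k)) => y.
  exact: (linearized_eq0 char2 cardK
    (a := fun k => \sum_l (M k l + M l k) * fr l y) (BE^~ y)).
split=> // k.
have diag x : \sum_k M k k * fr k x ^+ 2 = 0.
  rewrite -[RHS](M0 x); symmetry; rewrite pair_big /=.
  rewrite (bigID (fun ij : I * I => ij.1 == ij.2)) /=.
  rewrite [X in _ + X](bigID (fun ij : I * I => ij.1 < ij.2)%N) /=.
  rewrite [X in _ + (_ + X)](reindex_inj (can_inj swap_pairK)) /=.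
  rewrite [X in _ + (_ + X)]
    (eq_bigl (fun ij : I * I => (ij.1 != ij.2) && (ij.1 < ij.2)%N)); last first.
    by case=> i j /=; rewrite eq_sym -val_eqE /=; case: ltngtP.
  rewrite -big_split /= [X in _ + X]big1 ?addr0; last first.
    by case=> i j _ /=; rewrite [fr j x * _]mulrC -mulrDl Malt mul0r.
  rewrite (eq_bigl (fun ij : I * I => (ij.2 == ij.1))) => [|[i j]]; last first.
    by rewrite eq_sym.
  rewrite -(pair_big_dep xpredT (fun i j : I => j == i)
     (fun i j => M i j * (fr i x * fr j x))) /=.
  by apply: eq_bigr => i _; rewrite big_pred1_eq -expr2.
have := linearized_eq0 char2 cardK (a := fun k => M (k - inZp 1) (k - inZp 1)).
move=> /(_ _ (k + inZp 1)%R); rewrite addrK; apply=> x.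
rewrite (reindex_inj (addIr (inZp 1 : I))) -[RHS](diag x).
apply: eq_bigr => i _; rewrite addrK frobenius_addI.
by rewrite [X in _ * X]frobenius_mod expn1.
Qed.

(** Write al as a linearized polynomial with coefficients a.  The right-hand side
    has coefficient c a_k a'_l at x^(2^k) x^(2^l), where a' is a shifted by t and
    twisted, while the left-hand side only has terms with l = k + s.  Take k with
    a_k nonzero.  The diagonal term at k forces a'_k = 0, so the sum of the
    coefficients at (k, k + t) and (k + t, k) is c a_k a'_(k+t), which is not 0.
    Therefore (k, k + t) or its transpose lies on the line l = k + s. *)
Lemma gold_exponent (L al : K -> K) (e c : K) s t :
    {morph L : x y / x + y} -> {morph al : x y / x + y} ->
    s != 0 -> c != 0 -> (exists x, al x != 0) ->
    (forall x, L (e * (x * fr s x)) = c * (al x * fr t (al x))) ->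
  t = s \/ t = - s.
Proof.
move=> LD alD sn0 cn0 [x0 alx0] E.
have [a aE] := linearized_surj char2 cardK alD.
have [b bE] := linearized_surj char2 cardK LD.
have [k ak | a0] := pickP (fun k => a k != 0); last first.
  case/eqP: alx0; rewrite aE big1 // => k _.
  by have/eqP-> := negbFE (a0 k); rewrite mul0r.
pose a' l := fr t (a (l - t)).
have a'E x : fr t (al x) = \sum_l a' l * fr l x.
  rewrite aE (big_morph (fun y => fr t y) (frobeniusD char2 t)
    (id1 := 0) (op1 := +%R)); last first.
    by rewrite expr0n expn_eq0.
  rewrite [RHS](reindex_inj (addIr t)) /=; apply: eq_bigr => l _.
  by rewrite /a' addrK exprMn -frobenius_addI.
pose M k l := c * (a k * a' l) - (if l == k + s then b k * fr k e else 0).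
have [|Malt Mdiag] := quadratic_eq0 (M := M).
  move=> x; rewrite /M; under eq_bigr do under eq_bigr do rewrite mulrBl.
  under eq_bigr do rewrite sumrB; rewrite sumrB; apply/eqP; rewrite subr_eq0.
  apply/eqP; transitivity (c * (al x * fr t (al x))).
    rewrite a'E aE mulr_suml mulr_sumr; apply: eq_bigr => i _.
    rewrite mulr_sumr mulr_sumr; apply: eq_bigr => j _.
    ring.
  rewrite -E bE; apply: eq_bigr => i _.
  rewrite (bigD1 (i + s)) //= eqxx big1 ?addr0 => [|j /negbTE ->]; last first.
    by rewrite mul0r.
  by rewrite !exprMn frobenius_addI -!exprM [(2 ^ s * 2 ^ i)%N]mulnC !mulrA.
have [->|tns] := eqVneq t s; first by left.
have [->|tnNs] := eqVneq t (- s); first by right.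
have a'kt : a' (k + t) != 0 by rewrite /a' addrK expf_neq0.
have ck : a' k = 0.
  have ks : (k == k + s) = false.
    by rewrite -subr_eq0 opprD addrA subrr sub0r oppr_eq0 (negbTE sn0).
  have /eqP := Mdiag k; rewrite /M ks subr0 !mulf_eq0.
  by rewrite (negbTE cn0) (negbTE ak) => /eqP.
have kts : (k == k + t + s) = false.
  by rewrite -subr_eq0 -addrA opprD addrA subrr sub0r oppr_eq0 addr_eq0 (negbTE tnNs).
have /eqP := Malt k (k + t); rewrite /M (inj_eq (addrI k)) (negbTE tns) kts.
rewrite !subr0 ck !mulr0 addr0 !mulf_eq0.
by rewrite (negbTE cn0) (negbTE ak) (negbTE a'kt).
Qed.

End QuadraticCoefficients.

Lemma gold_exponent_nat (K : finFieldType) (n s t : nat)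
    (L al : K -> K) (e c : K) :
    2%N \in [pchar K] -> (0 < n)%N -> #|K| = (2 ^ n)%N ->
    {morph L : x y / x + y} -> {morph al : x y / x + y} ->
    ~~ (n %| s)%N -> c != 0 -> (exists x, al x != 0) ->
    (forall x, L (e * (x * x ^+ (2 ^ s))) = c * (al x * al x ^+ (2 ^ t))) ->
  (t == s %[mod n])%N || (n %| t + s)%N.
Proof.
case: n => // m char2 _ cardK LD alD ns cn0 aln0 E.
have ordE (j k : nat) : (inZp j == inZp k :> 'I_m.+1) = (j == k %[mod m.+1])%N.
  by rewrite -val_eqE.
have Z0 : 0 = inZp 0 :> 'I_m.+1 by apply: val_inj; rewrite /= mod0n.
have s_n0 : inZp s != 0 :> 'I_m.+1 by rewrite Z0 ordE mod0n.
have E' x : L (e * (x * x ^+ (2 ^ (inZp s : 'I_m.+1)))) =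
            c * (al x * al x ^+ (2 ^ (inZp t : 'I_m.+1))).
  by rewrite !(frobenius_mod cardK).
have [/eqP ts|/eqP ts] := gold_exponent char2 cardK LD alD s_n0 cn0 aln0 E'.
- by rewrite -ordE ts.
apply/orP; right; move: ts.
rewrite -addr_eq0; suff -> : inZp t + inZp s = inZp (t + s) :> 'I_m.+1.
  by rewrite Z0 ordE mod0n.
by apply: val_inj; rewrite /= modnDm.
Qed.

(** * The groups A(n, theta) *)

Lemma gf2_addxx n (x : GF two n) : x + x = 0.
Proof. exact: (addrr_pchar2 (GF_pchar two n)). Qed.

Lemma field_AutD F (th : [subg field_Aut F]) : {morph sgval th : x y / x + y}.
Proof. by have /field_AutP[] := subgP th. Qed.

Lemma field_AutM F (th : [subg field_Aut F]) : {morph sgval th : x y / x * y}.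
Proof. by have /field_AutP[] := subgP th. Qed.

Lemma field_Aut0 F (th : [subg field_Aut F]) : sgval th 0 = 0.
Proof. exact: morph0 (field_AutD th). Qed.

Lemma field_Aut_eq0 F (th : [subg field_Aut F]) x :
  (sgval th x == 0) = (x == 0).
Proof. by rewrite -(inj_eq perm_inj x 0 : (sgval th x == sgval th 0) = _) field_Aut0. Qed.

Lemma field_Aut1 F (th : [subg field_Aut F]) : sgval th 1 = 1.
Proof.
apply: (mulfI (x := sgval th 1)); last by rewrite -field_AutM !mulr1.
by rewrite -(field_Aut0 th) (inj_eq perm_inj) oner_eq0.
Qed.

Lemma field_AutMul F (s t : [subg field_Aut F]) x :
  sgval (s * t)%g x = sgval t (sgval s x).
Proof. exact: permM. Qed.

Lemma field_AutId F x : sgval (1%g : [subg field_Aut F]) x = x.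
Proof. exact: perm1. Qed.

Lemma theta0XE n i x : sgval (theta0 n ^+ i)%g x = x ^+ (2 ^ i).
Proof.
elim: i x => [|i IH] x; first by rewrite field_AutId expr1.
by rewrite expgSr field_AutMul IH theta0E -exprM expnSr.
Qed.

Lemma prim_root_neq0 (F : fieldType) n (z : F) : n.-primitive_root z -> z != 0.
Proof.
move=> zn; apply/eqP => z0; have := prim_expr_order zn.
by rewrite z0 expr0n gtn_eqF ?(prim_order_gt0 zn) // => /eqP; rewrite eq_sym oner_eq0.
Qed.

(** A proper power of theta0 cannot fix a generator of the multiplicative group. *)
Lemma order_theta0 n : (0 < n)%N -> #[theta0 n]%g = n.
Proof.
move=> n_gt0; apply/eqP; rewrite eqn_leq; apply/andP; split.
  apply: dvdn_leq => //; rewrite order_dvdn.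
  by apply/eqP/val_inj/permP=> x; rewrite theta0XE GF_exp_card field_AutId.
have [z zprim] := @exists_primitive_root (GF two n) _ (dvdnn _).
rewrite card_GF // in zprim; set k := #[_]%g.
have k_gt0 : (0 < k)%N := order_gt0 _.
have p_gt0 j : (0 < 2 ^ j)%N by rewrite expn_gt0.
have zk : z ^+ (2 ^ k) = z by rewrite -theta0XE expg_order field_AutId.
rewrite -(leq_exp2l (m := 2)) // -[leqLHS]prednK // -[leqRHS]prednK // ltnS.
apply: dvdn_leq; first by rewrite -ltnS prednK // -{1}(expn0 2) ltn_exp2l.
rewrite (prim_order_dvd zprim); apply/eqP/(mulfI (prim_root_neq0 zprim)).
by rewrite -exprS prednK // zk mulr1.
Qed.

Lemma field_Aut_theta0 n (th : [subg field_Aut (GF two n)]) : (0 < n)%N ->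
  exists k, th = (theta0 n ^+ k)%g.
Proof.
case: n th => // m th _.
have [k kE] := field_morph_frobenius (GF_pchar two m.+1)
  (card_GF two (ltn0Sn m)) (field_AutD th) (field_AutM th) perm_inj.
exists k; apply/val_inj/permP=> x; rewrite [LHS]kE.
by rewrite [RHS]theta0XE.
Qed.

Section FamilyA.

Variables (n : nat) (th : [subg field_Aut (GF two n)]).
Local Notation K := (GF two n).
Local Notation b := (Biadditive (A_cocycleDl th) (A_cocycleDr th)).

(** Commuting with w = 1 gives th u = u; commuting with w then gives th w = w. *)
Lemma A_nondegenerate : th != 1%g -> commutator_nondegenerate b.
Proof.
move=> th_n1 u uC; apply: contraNeq th_n1 => u_n0.
have thu : sgval th u = u by have := uC 1; rewrite /= /A_cocycle field_Aut1 mulr1 mul1r.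
apply/eqP/val_inj/permP => w; rewrite [RHS]field_AutId; apply: (mulfI u_n0).
by have := uC w; rewrite /= /A_cocycle thu mulrC => ->; rewrite mulrC.
Qed.

(** If c th(c) = 1 then th^2 fixes c; as th has odd order it is a power of th^2,
    so th fixes c too, and c^2 = 1 forces c = 1 in characteristic 2. *)
Lemma A_norm_inj : odd #[th]%g -> injective (fun a : K => a * sgval th a).
Proof.
move=> th_odd a a' /= aa'; have [a'0|a'n0] := eqVneq a' 0.
  move/eqP: aa'; rewrite a'0 mul0r mulf_eq0 field_Aut_eq0 orbb.
  by move/eqP.
have th_n0 : sgval th a' != 0 by rewrite field_Aut_eq0.
have [c aE] : exists c, a = c * a' by exists (a / a'); rewrite divfK.
suff c1 : c = 1 by rewrite aE c1 mul1r.
have cE : c * sgval th c = 1.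
  apply: (mulIf (mulf_neq0 a'n0 th_n0)).
  by rewrite mul1r -[RHS]aa' aE field_AutM mulrACA.
have cn0 : c != 0 by apply: contra_eq_neq cE => ->; rewrite mul0r eq_sym oner_neq0.
have th2c : sgval (th ^+ 2)%g c = c.
  apply: (mulfI (x := sgval th c)); first by rewrite field_Aut_eq0.
  by rewrite field_AutMul -field_AutM cE field_Aut1 mulrC cE.
have thc : sgval th c = c.
  have th2i i : sgval ((th ^+ 2) ^+ i)%g c = c.
    by elim: i => [|i IH]; rewrite ?field_AutId // expgS field_AutMul th2c.
  have odd2 : (2 * #[th]%g./2.+1 = #[th]%g.+1)%N.
    by rewrite mul2n doubleS -[in RHS](odd_double_half #[th]%g) th_odd.
  by have := th2i #[th]%g./2.+1; rewrite -expgM odd2 expgS expg_order mulg1.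
have : (c - 1) ^+ 2 == 0.
  rewrite sqrrB1 -mulr_natr -[2%:R]/(1 + 1) gf2_addxx mulr0 subr0.
  by rewrite expr2 -{2}thc cE gf2_addxx.
by rewrite expf_eq0 subr_eq0 => /eqP.
Qed.

Lemma three_orbit_A : odd #[th]%g -> th != 1%g -> three_orbit (A_group th).
Proof.
move=> th_odd th_n1.
have mulD (a : K) : {morph ( *%R a) : x y / x + y} := mulrDr a.
have simil (a : K) : a != 0 -> similitude b ( *%R a) ( *%R (a * sgval th a)).
  move=> an0; have nan0 : a * sgval th a != 0.
    by rewrite mulf_neq0 ?field_Aut_eq0.
  split=> //; try exact: mulfI.
  by move=> x y; rewrite /= /A_cocycle field_AutM; ring.
apply: (@three_orbit_cocycle _ _ b 1 1); rewrite ?oner_neq0 //.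
- exact: A_nondegenerate.
- move=> u u' un0 u'n0; exists ( *%R (u' / u)), ( *%R (u' / u * sgval th (u' / u))).
    by apply: simil; rewrite mulf_neq0 ?invr_eq0.
  by rewrite divfK.
- move=> v v' vn0 v'n0; have [g _ gK] := injF_bij (A_norm_inj th_odd).
  exists ( *%R (g (v' / v))), ( *%R (g (v' / v) * sgval th (g (v' / v)))).
    apply: simil; apply: contra_eq_neq (gK (v' / v)) => /= ->.
    by rewrite mul0r eq_sym mulf_neq0 ?invr_eq0.
  by rewrite /= gK divfK.
move=> u w un0; exists (fun x => w * (x / u)) => [x y|]; last by rewrite divff ?mulr1.
by rewrite mulrDl mulrDr.
Qed.

(** Applying th^-1 to th x * y gives x * th^-1 y, which is the cocycle of th^-1
    with its arguments exchanged; the two differ by the coboundary of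
    x |-> th^-1 x * x. *)
Lemma A_isog_inv : [set: A_group th] \isog [set: A_group th^-1%g].
Proof.
have thVK : cancel (sgval th) (sgval th^-1%g) := permK _.
pose V x := sgval th^-1%g x.
apply: (@cocycle_isog _ _ _ _ _ _ id V (fun x => V x * x)) => //.
- exact: field_AutD.
- exact: perm_inj.
move=> x y; rewrite /= /A_cocycle /V field_AutM thVK field_AutD.
have -> : x * V y + (V x + V y) * (x + y)
    = V x * y + (V x * x + V y * y) + (x * V y + x * V y) by ring.
by rewrite gf2_addxx addr0.
Qed.

End FamilyA.

Lemma phiXE n i : (phi n ^+ i)%g = (theta0 n ^+ (n`_2 * i)%N)%g.
Proof. by rewrite expgM. Qed.

Lemma order_phi n : (0 < n)%N -> #[phi n]%g = (n`_2^')%N.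
Proof.
move=> n_gt0; rewrite /phi orderXdiv order_theta0 ?dvdn_part //.
by rewrite -{1}(partnC 2%N n_gt0) mulKn ?part_gt0.
Qed.

Lemma odd_part2C n : odd (n`_2^')%N.
Proof. by rewrite odd_2'nat part_pnat. Qed.

Lemma phiX_odd n i : (0 < n)%N -> odd #[phi n ^+ i]%g.
Proof.
move=> n_gt0; apply: dvdn_odd (odd_part2C n).
by rewrite -order_phi // orderXdvd.
Qed.

Lemma phiX_neq1 n i : (0 < n)%N -> (1 <= i <= (n`_2^' - 1) %/ 2)%N ->
  (phi n ^+ i)%g != 1%g.
Proof.
move=> n_gt0 /andP[i_gt0 le_i]; rewrite -order_dvdn order_phi //.
by apply/negP => /dvdn_leq; lia.
Qed.

(** A power theta0^k of odd order has an exponent divisible by the 2-part of n. *)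
Lemma odd_order_phi n (th : [subg field_Aut (GF two n)]) : (0 < n)%N ->
  odd #[th]%g -> exists2 j, (j < n`_2^')%N & th = (phi n ^+ j)%g.
Proof.
move=> n_gt0 th_odd; have [k thE] := field_Aut_theta0 th n_gt0.
have : (n`_2 %| k)%N.
  rewrite -(@Gauss_dvdl _ _ #[th]%g); last first.
    by rewrite p_part coprimeXl // coprime2n.
  apply: dvdn_trans (dvdn_part 2%N n) _.
  by rewrite -{1}(order_theta0 n_gt0) order_dvdn expgM -thE expg_order.
case/dvdnP=> j kE; exists (j %% n`_2^')%N; first by rewrite ltn_mod part_gt0.
by rewrite -order_phi // expg_mod_order phiXE thE kE mulnC.
Qed.

(** One of j and n_2' - j is at most (n_2' - 1) / 2, and the corresponding powers
    of phi are inverse to each other. *)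
Lemma A_group_listed n (th : [subg field_Aut (GF two n)]) : (0 < n)%N ->
    odd #[th]%g -> (1 < #[th]%g)%N ->
  exists2 i, (1 <= i <= (n`_2^' - 1) %/ 2)%N &
    [set: A_group th] \isog [set: A_group (phi n ^+ i)%g].
Proof.
move=> n_gt0 th_odd; have [j lt_j ->] := odd_order_phi n_gt0 th_odd.
have odd_n := odd_part2C n; case: (posnP j) => [->|j_gt0 _].
  by rewrite expg0 order1.
have [le_j|gt_j] := leqP j ((n`_2^' - 1) %/ 2)%N.
  by exists j; rewrite ?isog_refl ?j_gt0.
exists (n`_2^' - j)%N; first lia.
have -> : (phi n ^+ (n`_2^' - j)%N = (phi n ^+ j)^-1)%g; last exact: A_isog_inv.
apply/eqP; rewrite eq_sym eq_invg_mul -expgD subnKC ?(ltnW lt_j) //.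
by rewrite -order_phi // expg_order.
Qed.

(** The exponents n_2 i and n_2 j agree up to sign modulo n, and the range leaves
    only the sign plus. *)
Lemma A_group_phi_inj n i j : (0 < n)%N ->
    (1 <= i <= (n`_2^' - 1) %/ 2)%N -> (1 <= j <= (n`_2^' - 1) %/ 2)%N ->
    [set: A_group (phi n ^+ i)%g] \isog [set: A_group (phi n ^+ j)%g] ->
  i = j.
Proof.
move=> n_gt0 i_rng j_rng isoA.
have addK (x : GF two n) := gf2_addxx x.
have [al [be [alD beD al_inj _ E]]] := cocycle_isog_square
  (A_nondegenerate (phiX_neq1 n_gt0 i_rng))
  (A_nondegenerate (phiX_neq1 n_gt0 j_rng)) addK addK addK isoA.
have nE := partnC 2%N n_gt0.
have al1 : exists x, al x != 0.
  exists 1; apply: contraNneq (oner_neq0 (GF two n)) => al1.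
  by apply/eqP/al_inj; rewrite al1 (morph0 alD).
have := @gold_exponent_nat _ n (n`_2 * i)%N (n`_2 * j)%N be al 1 1
  (GF_pchar two n) n_gt0 (card_GF two n_gt0) beD alD.
have modE : (n`_2 * j == n`_2 * i %[mod n])%N = (j == i)%N.
  have mE k : ((n`_2 * k) %% n = n`_2 * (k %% n`_2^'))%N by rewrite muln_modr nE.
  rewrite !mE eqn_pmul2l ?part_gt0 //.
  by rewrite !modn_small; lia.
have dvdE k : (n %| n`_2 * k)%N = (n`_2^' %| k)%N.
  by rewrite -[X in (X %| _)%N]nE dvdn_pmul2l ?part_gt0.
rewrite oner_neq0 modE -mulnDr !dvdE.
case/(_ _ isT al1 _)/orP => [|x|/eqP //|].
- by apply/negP => /dvdn_leq; lia.
- have := E x; rewrite /= /A_cocycle !phiXE !theta0XE !mul1r => {}E.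
  by rewrite mulrC E mulrC.
by move/dvdn_leq; lia.
Qed.

(** * The groups B(n) and P *)

Lemma finField_root (F : finFieldType) (d k : nat) (z : F) :
  #|F|.-1 = (d * k)%N -> z ^+ d = 1 -> exists a, a ^+ k = z.
Proof.
move=> FE zd; have [g gprim] := @exists_primitive_root F _ (dvdnn _).
have N_gt0 := prim_order_gt0 gprim; rewrite FE in N_gt0 gprim.
have zN : z ^+ (d * k) = 1 by rewrite exprM zd expr1n.
have [[i _] /= zE] := prim_rootP gprim zN; move: zd; rewrite zE -exprM => /eqP.
rewrite -(prim_order_dvd gprim) mulnC dvdn_pmul2r; last first.
  by move: N_gt0; rewrite muln_gt0 => /andP[].
by case/dvdnP=> j ->; exists (g ^+ j); rewrite exprM.
Qed.

Lemma subGF_neq0 p m n : exists v : subGF p m n, v != 0.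
Proof.
have oneP : 1 \in @subGF_pred p m n by rewrite inE expr1n.
by exists (SubGF oneP); rewrite -val_eqE /= oner_neq0.
Qed.

Section TraceToSubfield.

Variable n : nat.
Local Notation K := (GF two (2 * n)).
Local Notation V := (subGF two (2 * n) n).
Implicit Types (x y : K) (v w : V).

Lemma subGFP v : subGF_val v ^+ (2 ^ n) = subGF_val v.
Proof. by apply/eqP; exact: (valP v). Qed.

Lemma exp2nK x : (x ^+ (2 ^ n)) ^+ (2 ^ n) = x.
Proof. by rewrite -exprM -expnD addnn -mul2n; exact: (GF_exp_card x). Qed.

Lemma gf2_expD j x y : (x + y) ^+ (2 ^ j) = x ^+ (2 ^ j) + y ^+ (2 ^ j).
Proof. exact: (GF_expD (p := two)). Qed.

Lemma add_conj_eq0 x : (add_conj x == 0) = (x ^+ (2 ^ n) == x).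
Proof.
rewrite -val_eqE /= addr_eq0 eq_sym; congr (_ == _).
by apply/eqP; rewrite eq_sym -addr_eq0 gf2_addxx.
Qed.

(** The default value 0 is never reached when c lies in the subfield. *)
Definition subGF_scale (c : K) (j : nat) v : V :=
  insubd 0 (c * (subGF_val v) ^+ (2 ^ j)).

Lemma subGF_scaleE c j v : c ^+ (2 ^ n) = c ->
  subGF_val (subGF_scale c j v) = c * (subGF_val v) ^+ (2 ^ j).
Proof.
move=> cn; rewrite /subGF_scale insubdK // inE exprMn cn exprAC.
by rewrite subGFP.
Qed.

Lemma similitude_add_conj (b : biadditive K V) (al : K -> K) (c : K) (j : nat) :
    {morph al : x y / x + y} -> injective al -> c != 0 -> c ^+ (2 ^ n) = c ->
    (forall x y,
      subGF_val (b (al x) (al y)) = c * subGF_val (b x y) ^+ (2 ^ j)) ->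
  similitude b al (subGF_scale c j).
Proof.
move=> alD al_inj cn0 cn E; split=> // [v w|v w /(congr1 val)|x y].
- by apply: val_inj; rewrite /= !subGF_scaleE //= gf2_expD mulrDr.
- rewrite /= !subGF_scaleE // => /(mulfI cn0)/eqP.
  rewrite -subr_eq0 => /eqP vw; apply/val_inj/eqP; rewrite -subr_eq0.
  have := GF_expD (p := two) j (subGF_val v) (- (subGF_val w)).
  rewrite (GF_expN (p := two)) [X in _ = X]vw => /eqP.
  by rewrite expf_eq0 => /andP[].
by apply: val_inj; rewrite /= subGF_scaleE.
Qed.

Lemma exp_add_conj j x :
  subGF_val (add_conj x) ^+ (2 ^ j) = subGF_val (add_conj (x ^+ (2 ^ j))).
Proof. by rewrite /= gf2_expD exprAC. Qed.

Lemma scale_add_conj c x : c ^+ (2 ^ n) = c ->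
  c * (subGF_val (add_conj x)) = subGF_val (add_conj (c * x)).
Proof. by move=> cn; rewrite /= exprMn cn mulrDr. Qed.

(** The element e / (e + e^q) has trace 1. *)
Lemma add_conj_hom (e u : K) w : e + e ^+ (2 ^ n) != 0 -> u != 0 ->
  exists2 h : K -> V, {morph h : x y / x + y} & h u = w.
Proof.
move=> dn0 un0; set d := e + _ in dn0.
have dn : d ^+ (2 ^ n) = d by rewrite gf2_expD exp2nK addrC.
exists (fun x => add_conj ((subGF_val w) / d * e * (x / u))) => [x y|].
  by rewrite -add_conjD -!mulrDr -mulrDl.
apply: val_inj; rewrite /= divff // mulr1 !exprMn exprVn dn subGFP -mulrDr.
by rewrite -/d divfK.
Qed.

Lemma subGF_ratio v w : v != 0 -> w != 0 ->
  let z := subGF_val w / subGF_val v in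
  [/\ z != 0, z ^+ (2 ^ n) = z & z ^+ (2 ^ n).-1 = 1].
Proof.
move=> vn0 wn0 z; have zn0 : z != 0.
  by rewrite mulf_neq0 ?invr_eq0 // -[0]/(val (0 : V)) (inj_eq val_inj).
have zq : z ^+ (2 ^ n) = z.
  by rewrite exprMn exprVn !subGFP.
split=> //; apply: (mulfI zn0); rewrite -exprS prednK ?expn_gt0 // mulr1.
exact: zq.
Qed.

Lemma subGF_scale_ratio v w : v != 0 -> w != 0 ->
  subGF_scale (subGF_val w / subGF_val v) 0 v = w.
Proof.
move=> vn0 wn0; have [_ zq _] := subGF_ratio vn0 wn0.
by apply: val_inj; rewrite /= subGF_scaleE // expr1 divfK.
Qed.

End TraceToSubfield.

Section FamilyB.

Variables (n : nat) (e : GF two (2 * n)).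
Hypotheses (n_gt0 : (0 < n)%N) (e_prim : (2 ^ n).+1.-primitive_root e).
Local Notation K := (GF two (2 * n)).
Local Notation b := (Biadditive (B_cocycleDl e) (B_cocycleDr e)).

Let cardK : #|K| = (2 ^ (2 * n))%N.
Proof. by rewrite card_GF // muln_gt0. Qed.

(** Otherwise e^q = e, hence e^2 = e^(q+1) = 1, against the order of e. *)
Lemma B_eps_trace : e + e ^+ (2 ^ n) != 0.
Proof.
apply/negP; rewrite addr_eq0 => /eqP e1.
have : e ^+ 2 == 1.
  have := prim_expr_order e_prim; rewrite exprS.
  have -> : e ^+ (2 ^ n) = e; last by move=> e2; rewrite expr2 e2.
  by apply/eqP; rewrite -subr_eq0 {2}e1 opprK gf2_addxx.
rewrite -(prim_order_dvd e_prim) => /dvdn_leq; rewrite ltnS.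
by move/(_ isT); have := ltn_expl n (isT : (1 < 2)%N); lia.
Qed.

(** The norm u^(q+1) lies in the subfield, so it comes out of the trace. *)
Lemma B_square u :
  subGF_val (b u u) = (e + e ^+ (2 ^ n)) * (u * u ^+ (2 ^ n)).
Proof. by rewrite /= !exprMn exp2nK; ring. Qed.

Lemma B_nondegenerate : commutator_nondegenerate b.
Proof.
move=> u uC; apply/eqP; apply: contraT => un0.
(* For this w one has u w^q = e, and the commutator is (e + e^q)^2. *)
have := uC ((e / u) ^+ (2 ^ n)); rewrite /= /B_cocycle => /eqP.
rewrite -subr_eq0 -val_eqE /= exp2nK [u * (e / u)]mulrC divfK //.
rewrite !exprMn !exprVn !exp2nK.
set f := e ^+ _; set g := u ^+ _.
have gn0 : g != 0 by rewrite expf_neq0.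
have -> : e * e + f * f - (f / g * g * e + e / u * u * f)
   = (e + f) ^+ 2 - ((f * e + f * e) + (f * e + f * e)).
  by rewrite !divfK //; ring.
by rewrite !gf2_addxx subr0 expf_eq0 /= (negbTE B_eps_trace).
Qed.

(** Multiplication by a scales the cocycle by the norm a^(q+1), and the norm maps
    onto the multiplicative group of the subfield. *)
Lemma three_orbit_B : three_orbit (B_group e).
Proof.
have simil (a : K) : a != 0 ->
    similitude b ( *%R a) (subGF_scale (a ^+ (2 ^ n).+1) 0).
  move=> an0; have aq : (a ^+ (2 ^ n).+1) ^+ (2 ^ n) = a ^+ (2 ^ n).+1.
    by rewrite exprS exprMn exp2nK mulrC.
  apply: similitude_add_conj => //; try exact: mulfI.
  - exact: mulrDr.
  - by rewrite expf_neq0.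
  move=> x y; rewrite expr1 /B_cocycle scale_add_conj //.
  by congr (subGF_val (add_conj _)); rewrite exprMn exprS; ring.
have [v0 v0n0] := subGF_neq0 two (2 * n) n.
apply: (@three_orbit_cocycle _ _ b 1 v0 (oner_neq0 _) v0n0).
- exact: B_nondegenerate.
- move=> u u' un0 u'n0; exists ( *%R (u' / u)), (subGF_scale ((u' / u) ^+ (2 ^ n).+1) 0).
    by apply: simil; rewrite mulf_neq0 ?invr_eq0.
  by rewrite divfK.
- move=> v v' vn0 v'n0; have [zn0 _ z1] := subGF_ratio vn0 v'n0.
  have cardK1 : #|K|.-1 = ((2 ^ n).-1 * (2 ^ n).+1)%N.
    rewrite cardK mulnC expnM -subn1 -(exp1n 2) subn_sqr exp1n addn1.
    by rewrite subn1.
  have [a aE] := finField_root cardK1 z1.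
  exists ( *%R a), (subGF_scale (a ^+ (2 ^ n).+1) 0).
    by apply: simil; apply: contraNneq zn0 => a0; rewrite -aE a0 expr0n.
  by rewrite aE subGF_scale_ratio.
move=> u w un0; exact: add_conj_hom B_eps_trace un0.
Qed.

End FamilyB.

Section FamilyP.

Variable e : GF two (2 * 3).
Hypothesis e_prim : 63.-primitive_root e.
Local Notation K := (GF two (2 * 3)).
Local Notation b := (Biadditive (P_cocycleDl e) (P_cocycleDr e)).

Let cardK : #|K| = 64.
Proof. by rewrite card_GF. Qed.

Let exp63 (x : K) : x != 0 -> x ^+ 63 = 1.
Proof.
by move=> xn0; apply: (mulfI xn0); rewrite -exprS mulr1 -[RHS]expf_card cardK.
Qed.

Let e_exp i j : (e ^+ i == e ^+ j) = (i == j %[mod 63]).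
Proof. exact: eq_prim_root_expr. Qed.

(** If the trace vanishes then e u^3 lies in the field with 8 elements, so its 7th
    power is 1, and its 21st power e^21 as well, against the order of e. *)
Lemma P_eps_trace u : u != 0 -> add_conj (n := 3) (e * u ^+ 3) != 0.
Proof.
move=> un0; rewrite add_conj_eq0.
set y := e * _; have yn0 : y != 0.
  by rewrite mulf_neq0 ?expf_neq0 // (prim_root_neq0 e_prim).
apply/negP => /eqP; rewrite exprS -[in RHS](mulr1 y) => /(mulfI yn0) y7.
have /eqP : y ^+ 21 = 1 by rewrite (exprM y 7 3) y7 expr1n.
by rewrite exprMn -exprM (exp63 un0) mulr1 -(expr0 e) e_exp.
Qed.

(** For t in the field with 8 elements, t not 0 or 1, the commutator of u and u t
    is t + t^2 times the trace of e u^3. *)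
Lemma P_nondegenerate : commutator_nondegenerate b.
Proof.
move=> u uC; apply/eqP; apply: contraT => un0.
pose t := e ^+ 9; pose d := t + t ^+ 2.
have t8 : t ^+ (2 ^ 3) = t by apply/eqP; rewrite /t -exprM e_exp.
have d8 : d ^+ (2 ^ 3) = d by rewrite gf2_expD exprAC t8.
have dn0 : d != 0.
  rewrite /d expr2 -[X in X + _]mulr1 -mulrDr mulf_neq0 //.
    by rewrite expf_neq0 ?(prim_root_neq0 e_prim).
  rewrite addr_eq0; apply/negP => /eqP t1.
  have : t == 1 by rewrite -subr_eq0 t1 opprK gf2_addxx.
  by rewrite /t -(expr0 e) e_exp.
have /eqP := uC (u * t); rewrite -subr_eq0 /= /P_cocycle -val_eqE /=.
have := P_eps_trace un0; rewrite -val_eqE /= => /negbTE E0.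
set X := _ + _ - _.
suff -> : X = d * (subGF_val (add_conj (n := 3) (e * u ^+ 3))).
  by rewrite mulf_eq0 (negbTE dn0) /= E0.
rewrite scale_add_conj // /X /d /=.
have N (x y : K) : x - y = x + y.
  by apply/eqP; rewrite -subr_eq0 opprD addrACA subrr add0r -opprD gf2_addxx oppr0.
rewrite N addrACA -!gf2_expD; congr (_ + _ ^+ _); ring.
Qed.

(** The multiplications by a with a^21 = 1 scale the cocycle by a^3, which has
    order dividing 7 and so lies in the field with 8 elements.  They leave three
    orbits on nonzero elements, fused by the semilinear map x |-> e x^4, whose
    j-th iterate is x |-> e^(1 + 4 + ... + 4^(j-1)) x^(4^j). *)
Lemma P_similitude (a : K) (j : nat) : a ^+ 21 = 1 ->
  similitude b (fun x => a * e ^+ ((4 ^ j).-1 %/ 3) * x ^+ (2 ^ (2 * j)))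
    (subGF_scale (n := 3) (a ^+ 3) (2 * j)).
Proof.
move=> a21; have an0 : a != 0.
  by apply: contra_eq_neq a21 => ->; rewrite expr0n eq_sym oner_neq0.
have en0 : e != 0 := prim_root_neq0 e_prim.
have a8 : (a ^+ 3) ^+ (2 ^ 3) = a ^+ 3 by rewrite -exprM (exprD a 21 3) a21 mul1r.
have cn0 : a * e ^+ ((4 ^ j).-1 %/ 3) != 0 by rewrite mulf_neq0 ?expf_neq0.
have expN := GF_expN (p := two) (m := 2 * 3).
apply: similitude_add_conj => // [x y|x y||x y]; rewrite ?expf_neq0 //.
- by rewrite gf2_expD mulrDr.
- move/(mulfI cn0)/eqP; rewrite -subr_eq0 -expN -gf2_expD expf_eq0.
  by rewrite subr_eq0 => /andP[_ /eqP].
have bE z w : b z w = add_conj (n := 3) (z * w ^+ 2 * e) by [].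
rewrite !bE exp_add_conj scale_add_conj //; congr (subGF_val (add_conj _)).
have E : e ^+ (2 ^ (2 * j)) = e * (e ^+ ((4 ^ j).-1 %/ 3)) ^+ 3.
  rewrite -exprM divnK; last by rewrite predn_exp dvdn_mulr.
  by rewrite -exprS expnM prednK // expn_gt0.
rewrite !exprMn E; set f := e ^+ _; set g := y ^+ _; set h := x ^+ _; ring.
Qed.

Lemma three_orbit_P : three_orbit (P_group e).
Proof.
have [v0 v0n0] := subGF_neq0 two (2 * 3) 3.
apply: (@three_orbit_cocycle _ _ b 1 v0 (oner_neq0 _) v0n0).
- exact: P_nondegenerate.
- move=> u u' un0 u'n0.
  have e21 : 3.-primitive_root (e ^+ 21) by exact: (dvdn_prim_root e_prim (m := 3)).
  have z3 : ((u' / u) ^+ 21) ^+ 3 = 1.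
    by rewrite -exprM exp63 // mulf_neq0 ?invr_eq0.
  (* j is the number of iterates needed to reach the coset of u' / u modulo the
     21st roots of unity. *)
  have [j zE] := prim_rootP e21 z3.
  pose c := e ^+ ((4 ^ j).-1 %/ 3).
  have cn0 : c != 0 by rewrite expf_neq0 // (prim_root_neq0 e_prim).
  have uj : u ^+ (2 ^ (2 * j)) != 0 by rewrite expf_neq0.
  pose a := u' / (c * u ^+ (2 ^ (2 * j))).
  have uE : (u ^+ (2 ^ (2 * j))) ^+ 21 = u ^+ 21.
    have -> : (u ^+ (2 ^ (2 * j))) ^+ 21 = u ^+ (21 + 63 * \sum_(i < j) 4 ^ i).
      rewrite -exprM; congr (_ ^+ _); have := predn_exp 4 j.
      have : (0 < 4 ^ j)%N by rewrite expn_gt0.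
      rewrite (expnM 2 2 j : (2 ^ (2 * j) = 4 ^ j)%N); set s := (\sum_(i < j) _)%N; lia.
    by rewrite exprD exprM exp63 // expr1n mulr1.
  have cE : c ^+ 21 = (u' / u) ^+ 21.
    apply/eqP; rewrite zE /c -!exprM e_exp.
    by case: j {zE c cn0 uj a uE} => [[|[|[|j]]]].
  have a21 : a ^+ 21 = 1.
    rewrite /a exprMn exprVn [(c * _) ^+ 21]exprMn uE cE exprMn exprVn.
    by rewrite divfK ?expf_neq0 // divff ?expf_neq0.
  exists (fun x => a * c * x ^+ (2 ^ (2 * j))), (subGF_scale (n := 3) (a ^+ 3) (2 * j)).
    exact: P_similitude.
  by rewrite -mulrA divfK // mulf_neq0.
- move=> v v' vn0 v'n0; have [zn0 _ z1] := subGF_ratio vn0 v'n0.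
  have cardK1 : #|K|.-1 = (7 * 9)%N by rewrite cardK.
  (* Multiplication by a^3 scales the cocycle by a^9, the ratio of v' to v. *)
  have [a aE] := finField_root cardK1 z1.
  have an0 : a != 0 by apply: contraNneq zn0 => a0; rewrite -aE a0 expr0n.
  exists (fun x => a ^+ 3 * e ^+ ((4 ^ 0).-1 %/ 3) * x ^+ (2 ^ (2 * 0))).
  exists (subGF_scale (n := 3) ((a ^+ 3) ^+ 3) (2 * 0)).
    by apply: P_similitude; rewrite -exprM exp63.
  by rewrite -exprM aE subGF_scale_ratio.
move=> u w un0; apply: (add_conj_hom (n := 3) (e := e) w _ un0).
have := P_eps_trace (oner_neq0 _); rewrite expr1n mulr1 -val_eqE.
exact.
Qed.

End FamilyP.

(** Up to the trace and constants the squaring map is x^(1+2) for P and x^(1+8)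
    for B(3), with exponents s = 1 and t = 3; but 3 is not 1 or -1 modulo 6. *)
Lemma P_B_not_isog (eP eB : GF two (2 * 3)) :
    63.-primitive_root eP -> (2 ^ 3).+1.-primitive_root eB ->
  ~~ ([set: P_group eP] \isog [set: B_group (n := 3) eB]).
Proof.
move=> eP_prim eB_prim; apply/negP => isoPB.
have addK (x : GF two (2 * 3)) := gf2_addxx x.
have addV (v : subGF two (2 * 3) 3) : v + v = 0 by apply: val_inj; exact: addK.
have [al [be [alD beD al_inj _ E]]] := cocycle_isog_square
  (P_nondegenerate eP_prim) (B_nondegenerate (n := 3) isT eB_prim) addK addK addV isoPB.
suff : ((3 == 1 %[mod 6]) || (6 %| 3 + 1))%N by [].
apply: (@gold_exponent_nat _ 6 1 3
  (fun x => val (be (add_conj (n := 3) x))) al eP (eB + eB ^+ (2 ^ 3))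
  (GF_pchar two (2 * 3)) isT (card_GF two (isT : (0 < 2 * 3)%N))) => // [x y|||x].
- by rewrite add_conjD beD.
- exact: (B_eps_trace (n := 3)).
- exists 1; apply: contraNneq (oner_neq0 (GF two (2 * 3))) => al1.
  by apply/eqP/al_inj; rewrite al1 (morph0 alD).
by rewrite -(B_square (n := 3)) -E /= /P_cocycle mulrC.
Qed.

(** * Homocyclic groups *)

(** M is the identity matrix with its row i replaced by x. *)
Lemma delta_row_transfer (R : comUnitRingType) n (x : 'rV[R]_n) i :
  x 0 i \is a GRing.unit ->
  exists2 M : 'M_n, M \in unitmx & delta_mx 0 i *m M = x.
Proof.
move=> xi_unit; pose d : 'cV[R]_n := delta_mx i 0.
pose y := x - delta_mx 0 i.
exists (1%:M + d *m y); last first.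
  rewrite mulmxDr mulmx1 mulmxA mul_delta_mx.
  have -> : delta_mx 0 0 = 1%:M :> 'M[R]_1.
    by apply/matrixP=> k l; rewrite !ord1 !mxE !eqxx.
  by rewrite mul1mx addrC subrK.
pose z := - (x 0 i)^-1 *: y.
have yd : y *m d = (x 0 i - 1)%:M.
  apply/matrixP=> k l; rewrite !ord1 -colE !mxE !eqxx /=.
  by rewrite mulr1n.
apply: (proj1 (mulmx1_unit (B := 1%:M + d *m z) _)).
rewrite mulmxDr mulmx1 mulmxDl mul1mx -addrA -[RHS]addr0; congr (_ + _).
rewrite -mulmxA [y *m (d *m z)]mulmxA yd mul_scalar_mx -!mulmxDr.
apply/eqP; rewrite /z scalerA -{1}[y]scale1r -!scalerDl.
suff -> : 1 + (- (x 0 i)^-1 + (x 0 i - 1) * - (x 0 i)^-1) = 0.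
  by rewrite scale0r mulmx0.
rewrite -[X in _ + (X + _)]mul1r -mulrDl [1 + (x 0 i - 1)]addrC.
by rewrite subrK mulrN divrr // subrr.
Qed.

Lemma row_transfer (R : comUnitRingType) n (x y : 'rV[R]_n) i j :
    x 0 i \is a GRing.unit -> y 0 j \is a GRing.unit ->
  exists2 M : 'M_n, M \in unitmx & x *m M = y.
Proof.
move=> /delta_row_transfer[Mx uMx xE] /delta_row_transfer[My uMy yE].
exists (invmx Mx *m tperm_mx i j *m My).
  by rewrite !unitmx_mul unitmx_inv uMx uMy unitmx_perm.
rewrite -{1}xE !mulmxA mulmxK // -yE; congr (_ *m _).
by rewrite -rowE; apply/rowP=> k; rewrite !mxE tpermL eqxx eq_sym.
Qed.

Lemma row_transfer_field (F : fieldType) n (x y : 'rV[F]_n) :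
  x != 0 -> y != 0 -> exists2 M : 'M_n, M \in unitmx & x *m M = y.
Proof.
move=> /rV0Pn[i xi] /rV0Pn[j yj].
by apply: (row_transfer (i := i) (j := j)); rewrite unitfE.
Qed.

Lemma mulmx_unit_inj (R : comUnitRingType) n (M : 'M[R]_n) :
  M \in unitmx -> injective (fun x : 'rV_n => x *m M).
Proof. by move=> uM; apply: (can_inj (mulmxK uM)). Qed.

Section Homocyclic.

Variables (p : prime_nat) (n : nat).
Hypothesis n_gt0 : (0 < n)%N.
Local Notation R := 'Z_(p ^ 2).
Local Notation G := (homocyclic_p2 p n).

Let p_gt1 : (1 < p)%N. Proof. exact: prime_gt1 (prime_pnat p). Qed.
Let p2_gt1 : (1 < p ^ 2)%N. Proof. by rewrite -(exp1n 2) ltn_exp2r. Qed.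

Let R_eq0 (k : nat) : (k%:R == 0 :> R) = (p ^ 2 %| k)%N.
Proof. by rewrite -val_eqE /= val_Zp_nat. Qed.

Lemma Zp2_torsion (a : R) : (a *+ p == 0) = (p %| val a)%N.
Proof.
have p2E k : (p ^ 2 %| k * p)%N = (p %| k)%N.
  by rewrite expnS expn1 dvdn_pmul2r // ltnW.
by rewrite -{1}[a]natr_Zp -mulrnA R_eq0 p2E.
Qed.

Lemma Zp2_unit (a : R) : a *+ p != 0 -> a \is a GRing.unit.
Proof.
rewrite Zp2_torsion -[X in X \is a _]natr_Zp unitZpE // => npa.
by rewrite coprimeXl // prime_coprime ?prime_pnat.
Qed.

Lemma row_torsion_divisible (x : 'rV[R]_n) :
  x *+ p = 0 -> exists y, x = y *+ p.
Proof.
move=> /rowP x0; exists (\row_i (val (x 0 i) %/ p)%:R); apply/rowP=> i.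
rewrite mulmxnE mxE -mulrnA divnK ?natr_Zp // -Zp2_torsion.
by apply/eqP; have := x0 i; rewrite mulmxnE mxE.
Qed.

Lemma card_homocyclic_p2 : #|[set: G]| = (p ^ (2 * n))%N.
Proof. by rewrite cardsT card_mx card_ord Zp_cast // mul1n expnM. Qed.

Lemma homocyclic_p2_center : #|'Z([set: G])%g| = #|[set: G]|.
Proof. by congr #|pred_of_set _|; apply/center_idP; exact: zmod_abelian. Qed.

(** A row that p does not kill has a unit coordinate, and the rows that p kills
    are the p-multiples of arbitrary rows; so transitivity on rows with a unit
    coordinate settles both kinds. *)
Lemma three_orbit_homocyclic_p2 : three_orbit G.
Proof.
pose i0 := Ordinal n_gt0; pose x0 : 'rV[R]_n := delta_mx 0 i0.
have fusedM (x y : 'rV[R]_n) M : M \in unitmx -> x *m M = y -> @fused G x y.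
  move=> uM xy; exists (fun x : 'rV_n => x *m M); split=> //; last exact: mulmx_unit_inj.
  by move=> u v; rewrite !zmodMgE mulmxDl.
have unit_coord (x : 'rV[R]_n) : x *+ p != 0 -> exists i, x 0 i \is a GRing.unit.
  move=> /rV0Pn[i]; rewrite mulmxnE => xi; exists i; exact: Zp2_unit.
have x0p : x0 *+ p != 0.
  apply/rV0Pn; exists i0; rewrite mulmxnE mxE !eqxx Zp2_torsion /=.
  by rewrite modn_small ?Zp_cast // gtnNdvd.
have fuse (x y : 'rV[R]_n) : x *+ p != 0 -> y *+ p != 0 ->
    exists2 M : 'M_n, M \in unitmx & x *m M = y.
  by move=> /unit_coord[i xi] /unit_coord[j yj]; apply: row_transfer xi yj.
apply: (@three_orbit_of_fused G [pred x : 'rV[R]_n | x *+ p == 0] (x0 *+ p) x0).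
- rewrite inE /= -mulrnA mulnn; apply/eqP/rowP=> i.
  rewrite mulmxnE [RHS]mxE; move: (x0 0 i) => a.
  by apply/eqP; rewrite -[a]natr_Zp -mulrnA R_eq0 dvdn_mull.
- exact: x0p.
- by rewrite inE /= x0p.
- by rewrite inE /= zmod1gE mul0rn.
- move=> x y /fused_expg1 xy; rewrite !inE -!zmodXgE => /eqP xp.
  exact/eqP/xy.
- move=> x y; rewrite !inE => /eqP/row_torsion_divisible[x' ->].
  move=> /eqP/row_torsion_divisible[y' ->] xn1 yn1.
  have [M uM xy] := fuse x' y' xn1 yn1.
  by apply: (fusedM _ _ M) => //; rewrite -scaler_nat -scalemxAl xy scaler_nat.
by move=> x y; rewrite !inE => xp yp; have [M uM xy] := fuse x y xp yp; apply: fusedM xy.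
Qed.

End Homocyclic.

(** * Affine groups *)

Section Affine.

Variables (p r : prime_nat) (d : nat).
Hypotheses (p_neq_r : p != r) (p_prim : r.-1.-primitive_root (p%:R : 'F_r)).
Hypothesis d_gt0 : (0 < d)%N.
Local Notation F := (GF p r.-1).
Local Notation C := [subg unit_roots F r].
Local Notation G := (affine_group F r d).

Let r_gt1 : (1 < r)%N. Proof. exact: prime_gt1 (prime_pnat r). Qed.
Let r1_gt0 : (0 < r.-1)%N. Proof. by rewrite -ltnS prednK // ltnW. Qed.
Let cardF : #|F| = (p ^ r.-1)%N. Proof. exact: card_GF. Qed.

Let prime_p_r : coprime p r.
Proof.
by rewrite prime_coprime ?prime_pnat // dvdn_prime2 ?prime_pnat.
Qed.

Let natr_Fr_eq (i j : nat) : (i%:R == j%:R :> 'F_r) = (i == j %[mod r])%N.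
Proof. by rewrite -val_eqE /= !val_Fp_nat ?prime_pnat. Qed.

Lemma card_affine_roots : #|[set: C]| = r.
Proof.
rewrite -(card_isog (isog_subg _)); apply: card_unit_roots; rewrite cardF.
have p_gt0 : (0 < p ^ r.-1)%N by rewrite expn_gt0 prime_gt0 ?prime_pnat.
rewrite -subn1 -eqn_mod_dvd // -natr_Fr_eq natrX.
by rewrite (prim_expr_order p_prim).
Qed.

Lemma card_affine_group : #|[set: G]| = (r * p ^ (r.-1 * d))%N.
Proof.
rewrite cardsT card_prod card_mx mul1n cardF -expnM.
by have := card_affine_roots; rewrite cardsT => ->.
Qed.

Lemma affine_rootsX (l : C) : (l ^+ r = 1)%g.
Proof. by have := expg_cardG (in_setT l); rewrite card_affine_roots. Qed.

(** The residue of p generates the units modulo r. *)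
Lemma affine_roots_frobenius (l m : C) : l != 1%g -> m != 1%g ->
  exists i, m = (l ^+ (p ^ i))%g.
Proof.
move=> ln1 mn1; have ol : #[l]%g = r.
  have /primeP[_ /(_ #[l]%g)] := prime_pnat r.
  rewrite order_dvdn affine_rootsX eqxx order_eq1 (negbTE ln1) => /(_ isT).
  by move/eqP.
have : m \in <[l]>%g.
  suff -> : <[l]>%g = [set: C] by rewrite inE.
  by apply/eqP; rewrite eqEcard subsetT card_affine_roots -orderE ol /=.
case/cycleP=> j mE; have jn0 : j%:R != 0 :> 'F_r.
  rewrite -[0]/(0%:R) natr_Fr_eq mod0n; apply: contraNneq mn1 => j0.
  by rewrite mE -expg_mod_order ol j0.
have j1 : (j%:R : 'F_r) ^+ r.-1 = 1.
  apply: (mulfI jn0); rewrite -exprS prednK ?(ltnW r_gt1) // mulr1.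
  by have := expf_card (j%:R : 'F_r); rewrite card_Fp ?prime_pnat.
have [[i _] /= jE] := prim_rootP p_prim j1; exists i.
rewrite mE -expg_mod_order -[RHS]expg_mod_order ol; congr (_ ^+ _)%g.
by apply/eqP; rewrite -natr_Fr_eq natrX jE eqxx.
Qed.

Lemma affineM (x y : G) : (x * y)%g = ((x.1 * y.1)%g, scal y.1 *: x.2 + y.2) :> G.
Proof. by []. Qed.

Lemma scal_eq1 (l : C) : (scal l == 1) = (l == 1%g).
Proof. by rewrite -[1]/(scal (1%g : C)) /scal !val_eqE. Qed.

Lemma affine_expr_root k (x : G) : (x ^+ k)%g.1 = (x.1 ^+ k)%g.
Proof. by elim: k => [|k IH] //; rewrite !expgS affineM IH. Qed.

Lemma affine_expr_vec k v : (((1%g, v) : G) ^+ k)%g = (1%g, v *+ k).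
Proof.
elim: k => [|k IH] //; rewrite expgS affineM IH mulg1 mulrS.
by rewrite -[scal _]/1 scale1r.
Qed.

(** This makes the translation subgroup characteristic. *)
Lemma affine_expr_p (x : G) : ((x ^+ p)%g == 1%g) = (x.1 == 1%g).
Proof.
apply/eqP/eqP => [/(congr1 fst)|x1].
  rewrite affine_expr_root; move: x.1 => l lp.
  apply/eqP; rewrite -order_eq1 -dvdn1.
  have <- : gcdn p r = 1%N by apply/eqP; exact: prime_p_r.
  by rewrite dvdn_gcd !order_dvdn affine_rootsX eqxx andbT; apply/eqP.
have -> : x = (1%g, x.2) by rewrite -x1 -surjective_pairing.
rewrite affine_expr_vec; congr (_, _); apply/rowP=> i.
by rewrite mulmxnE mxE -mulr_natr (pcharf0 (GF_pchar p r.-1)) mulr0.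
Qed.

(** On translations, linear maps are transitive.  Off the translation subgroup the
    Frobenius map moves the first coordinate at will, and conjugating by
    translations then moves the second one. *)
Lemma three_orbit_affine : three_orbit G.
Proof.
have [l0 l0n1] : exists l : C, l != 1%g.
  have : [set: C] != 1%g by rewrite -cardG_gt1 card_affine_roots.
  by case/trivgPn=> l; exists l.
pose v0 : 'rV[F]_d := delta_mx 0 (Ordinal d_gt0).
have v0n0 : v0 != 0 by apply/rV0Pn; exists (Ordinal d_gt0); rewrite mxE !eqxx oner_neq0.
apply: (@three_orbit_of_fused G [pred x : G | x.1 == 1%g] (1%g, v0) (l0, 0)).
- by rewrite inE eqxx.
- by apply: contraNneq v0n0 => -[->].
- by rewrite inE.
- by rewrite inE eqxx.
- move=> x y /fused_expg1 xy; rewrite !inE -!affine_expr_p => /eqP xp.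
  exact/eqP/xy.
- move=> [l v] [m w]; rewrite !inE /= => /eqP-> /eqP-> vn1 wn1.
  have [||M uM vw] := @row_transfer_field F d v w.
  - by apply: contraNneq vn1 => ->.
  - by apply: contraNneq wn1 => ->.
  exists (fun x : G => (x.1, x.2 *m M)); split; last by rewrite /= vw.
    by move=> x y; rewrite !affineM /= mulmxDl scalemxAl.
  by move=> [l1 v1] [l2 v2] [-> /(mulmx_unit_inj uM)->].
move=> [l v] [m w]; rewrite !inE /= => ln1 mn1.
have [i mE] := affine_roots_frobenius ln1 mn1.
pose fr (x : F) := x ^+ (p ^ i).
have fr_inj : injective fr.
  move=> x y /eqP; rewrite -subr_eq0 -GF_expN -GF_expD expf_eq0 subr_eq0.
  by case/andP=> _ /eqP.
apply: (@fused_trans G ((m, map_mx fr v) : G)).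
  exists (fun x : G => ((x.1 ^+ (p ^ i))%g, map_mx fr x.2)).
  split=> [x y|[l1' v1] [l2 v2] []|].
  - rewrite !affineM /=; congr (_, _).
      by rewrite expgMn //; apply: val_inj; apply: val_inj; rewrite /= mulrC.
    apply/rowP=> k; rewrite !mxE /fr GF_expD exprMn; congr (_ * _ + _).
    by elim: (p ^ i)%N => // j IH; rewrite expgS exprS IH.
  - move=> l12 v12; congr (_, _).
      apply: (can_in_inj (expgK (G := [set: C]) _)) l12; rewrite ?inE //.
      by rewrite card_affine_roots coprimeXr // coprime_sym prime_p_r.
    by apply/rowP=> k; apply: fr_inj; have /rowP/(_ k) := v12; rewrite !mxE.
  by rewrite /= -mE.
have [c cE] : exists c, (scal m - 1) *: c = w - map_mx fr v.
  exists ((scal m - 1)^-1 *: (w - map_mx fr v)).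
  by rewrite scalerA divff ?scale1r // subr_eq0 scal_eq1.
exists (fun x : G => (x.1, x.2 + (scal x.1 - 1) *: c)); split.
- move=> x y; rewrite !affineM /=; congr (_, _).
  rewrite scalerDr scalerA -!addrA; congr (_ + _).
  rewrite [RHS]addrCA; congr (_ + _).
  by rewrite scalM -scalerDl; congr (_ *: _); ring.
- by move=> [l1' v1] [l2 v2] [-> /addIr->].
by rewrite /= cE addrC subrK.
Qed.

End Affine.

(** * Vectors and bivectors in dimension 3 *)

(** The transposes of A and B are row full, so they have the same row space and
    differ by an invertible factor. *)
Lemma row_free_transfer (F : fieldType) k n (A B : 'M[F]_(k, n)) :
  row_free A -> row_free B -> exists2 M : 'M_n, M \in unitmx & A *m M = B.
Proof.
move=> Afree Bfree; have full (C : 'M[F]_(k, n)) : row_free C -> row_full C^T.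
  by rewrite /row_free /row_full mxrank_tr.
have : (B^T == A^T)%MS by rewrite !submx_full ?full.
case/eqmxMunitP=> M uM /(congr1 trmx); rewrite trmx_mul !trmxK => ->.
by exists M^T; rewrite ?unitmx_tr.
Qed.

Section ExteriorSquare.

Variable F : finFieldType.
Implicit Types (v w : 'rV[F]_3) (z : ext2 F 3) (M : 'M[F]_3).
Local Notation b := (Biadditive (@wedgeDl F) (@wedgeDr F)).

Lemma wedgeZl a v w : wedge (a *: v) w = a *: wedge v w.
Proof.
apply/ffunP=> -[[i j] ij]; rewrite !ffunE /= !mxE.
rewrite -[a *: _]/(a * _); ring.
Qed.

Lemma wedgeC v w : wedge w v = - wedge v w.
Proof. by apply/ffunP=> -[[i j] ij]; rewrite !ffunE /=; ring. Qed.

Lemma wedgeZr a v w : wedge v (a *: w) = a *: wedge v w.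
Proof. by rewrite wedgeC wedgeZl [in LHS]wedgeC scalerN opprK. Qed.

Lemma wedge_self v : wedge v v = 0.
Proof. by apply/ffunP=> -[[i j] ij]; rewrite !ffunE /=; ring. Qed.

Section WedgeMul.

Variable M : 'M[F]_3.
Definition wedge_mul v w := wedge (v *m M) (w *m M).

Fact wedge_mul_bilinear : bilinear_for *:%R *:%R wedge_mul.
Proof.
by split=> u a v w; rewrite /wedge_mul mulmxDl -scalemxAl
  (wedgeDl, wedgeDr) (wedgeZl, wedgeZr).
Qed.
HB.instance Definition _ := bilinear_isBilinear.Build F 'rV[F]_3 'rV[F]_3
  (ext2 F 3) *:%R *:%R wedge_mul wedge_mul_bilinear.

Lemma wedge_mul_additive : exists2 be : ext2 F 3 -> ext2 F 3,
  {morph be : x y / x + y} &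
  forall v w, wedge (v *m M) (w *m M) = be (wedge v w).
Proof.
have [v|h hE _] := @wedge_universal F 3 (ext2 F 3)
  (wedge_mul : {bilinear 'rV_3 -> 'rV_3 -> ext2 F 3}); first exact: wedge_self.
by exists h => // x y; exact: linearD.
Qed.

End WedgeMul.

Let o0 : 'I_3 := @Ordinal 3 0 isT.
Let o1 : 'I_3 := @Ordinal 3 1 isT.
Let o2 : 'I_3 := @Ordinal 3 2 isT.
Let T := {ij : 'I_3 * 'I_3 | (ij.1 < ij.2)%N}.
Let t01 : T := exist _ (o0, o1) isT.
Let t02 : T := exist _ (o0, o2) isT.
Let t12 : T := exist _ (o1, o2) isT.

Let T_cases (t : T) : [\/ t = t01, t = t02 | t = t12].
Proof.
have Teq (t' : T) : nat_of_ord (val t).1 = (val t').1 ->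
    nat_of_ord (val t).2 = (val t').2 -> t = t'.
  move=> eq1 eq2; apply: val_inj; rewrite [LHS]surjective_pairing.
  by rewrite (val_inj eq1) (val_inj eq2) -surjective_pairing.
case: t Teq => -[[i i3] [j j3]] /= ij Teq.
case: i i3 ij Teq => [|[|i]] i3 ij Teq; case: j j3 ij Teq => [|[|[|j]]] j3 ij Teq //.
- by apply: Or31; apply: Teq.
- by apply: Or32; apply: Teq.
- by apply: Or33; apply: Teq.
Qed.

Lemma card_ext2 : #|{: ext2 F 3}| = (#|F| ^ 3)%N.
Proof.
rewrite card_ffun; congr (_ ^ _)%N.
have -> : #|{: T}| = #|[:: t01; t02; t12]|.
  by apply: eq_card => t; rewrite !inE; symmetry; apply/or3P;
    case: (T_cases t) => ->; [apply: Or31 | apply: Or32 | apply: Or33]; exact: eqxx.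
have /card_uniqP-> : uniq [:: t01; t02; t12] by [].
by [].
Qed.

(** Special to dimension 3: divide by a nonzero coordinate of z. *)
Lemma ext2_decomposable z : exists v w, z = wedge v w.
Proof.
pose row3 a b c : 'rV[F]_3 := \row_k nth 0 [:: a; b; c] k.
have wedge3 a b c a' b' c' (v := row3 a b c) (w := row3 a' b' c') :
    (z t01 : F) = a * b' - b * a' -> (z t02 : F) = a * c' - c * a' ->
    (z t12 : F) = b * c' - c * b' -> z = wedge v w.
  by move=> E1 E2 E3; apply/ffunP=> t; rewrite ffunE; case: (T_cases t) => ->;
    rewrite /= !mxE.
set x := (z t01 : F) in wedge3; set y := (z t02 : F) in wedge3.
set u := (z t12 : F) in wedge3.
have [x0|xn0] := eqVneq x 0; last first.
  exists (row3 1 0 (- u / x)), (row3 0 x y); apply: wedge3; field; by rewrite ?xn0.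
have [y0|yn0] := eqVneq y 0.
  by exists (row3 0 1 0), (row3 0 0 u); apply: wedge3; rewrite ?x0 ?y0; ring.
exists (row3 1 (u / y) 0), (row3 0 x y); apply: wedge3; field; by rewrite ?yn0.
Qed.

(** Bivectors being decomposable, the map induced by M^-1 is a left inverse. *)
Lemma wedge_mul_inj M be : M \in unitmx ->
  (forall v w, wedge (v *m M) (w *m M) = be (wedge v w)) -> injective be.
Proof.
move=> uM beE; have [be' _ be'E] := wedge_mul_additive (invmx M).
apply: (can_inj (g := be')) => z; have [v [w ->]] := ext2_decomposable z.
by rewrite -beE -be'E !mulmxK.
Qed.

Lemma wedge_similitude M : M \in unitmx ->
  exists2 be, similitude b (mulmxr M) be &
    forall v w, be (wedge v w) = wedge (v *m M) (w *m M).
Proof.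
move=> uM; have [be beD beE] := wedge_mul_additive M.
exists be => //; split=> // [v w||].
- exact: mulmxDl.
- exact: mulmx_unit_inj.
exact: wedge_mul_inj beE.
Qed.

(** Wedging a linear relation between v and w with w, then with v, kills its
    coefficients. *)
Lemma wedge_neq0_row_free v w : wedge v w != 0 -> row_free (col_mx v w).
Proof.
move=> vwn0; apply: inj_row_free => u.
have cE (c : 'M[F]_1) (x : 'rV[F]_3) : c *m x = c 0 0 *: x.
  by rewrite [c in LHS]mx11_scalar mul_scalar_mx.
rewrite -[u]hsubmxK mul_row_col !cE.
set l := lsubmx u; set r := rsubmx u => uE.
have scale0 (a : F) : a *: wedge v w = 0 -> a = 0.
  by move/eqP; rewrite scaler_eq0 (negbTE vwn0) orbF => /eqP.
have l0 : l 0 0 = 0.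
  apply: scale0; rewrite -wedgeZl -[LHS]addr0 -[X in _ + X](scaler0 _ (r 0 0)).
  by rewrite -(wedge_self w) -wedgeZl -wedgeDl uE /wedge; apply/ffunP=> -[[i j] ij];
    rewrite !ffunE /= !mxE; ring.
have r0 : r 0 0 = 0.
  apply: scale0; rewrite -wedgeZr; move: uE; rewrite l0 scale0r add0r => ->.
  by apply/ffunP=> -[[i j] ij]; rewrite !ffunE /= !mxE; ring.
rewrite [l]mx11_scalar [r]mx11_scalar l0 r0.
by apply/rowP=> k; rewrite !mxE; case: split => ?; rewrite !mxE mul0rn.
Qed.

Hypothesis F2 : 2%:R != 0 :> F.

Let e0 : 'rV[F]_3 := delta_mx 0 o0.
Let e1 : 'rV[F]_3 := delta_mx 0 o1.
Let e01_neq0 : wedge e0 e1 != 0.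
Proof.
apply/eqP => /ffunP/(_ t01); rewrite !ffunE /= !mxE /= mulr1 mul0r subr0.
by move/eqP; rewrite oner_eq0.
Qed.

Lemma ext_nondegenerate : commutator_nondegenerate b.
Proof.
move=> u uC; apply/eqP; apply: contraT => un0; have e0n0 : e0 != 0.
  by apply/rV0Pn; exists o0; rewrite mxE !eqxx oner_neq0.
have [M uM uE] := row_transfer_field e0n0 un0.
have [be beD beE] := wedge_mul_additive M.
have be0 := morph0 beD.
case/eqP: e01_neq0; apply: (wedge_mul_inj uM beE); rewrite be0 -beE uE.
apply/eqP; have /eqP := uC (e1 *m M); rewrite /= [wedge _ u]wedgeC -addr_eq0.
by rewrite -mulr2n -scaler_nat scaler_eq0 (negbTE F2).
Qed.

Lemma three_orbit_ext : three_orbit (ext_group F).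
Proof.
have e0n0 : e0 != 0 by apply/rV0Pn; exists o0; rewrite mxE !eqxx oner_neq0.
apply: (@three_orbit_cocycle _ _ b e0 (wedge e0 e1)) => //.
- exact: ext_nondegenerate.
- move=> u u' un0 u'n0; have [M uM uE] := row_transfer_field un0 u'n0.
  by have [be beS _] := wedge_similitude uM; exists (mulmxr M), be.
- move=> z z'; have [v [w ->]] := ext2_decomposable z.
  have [v' [w' ->]] := ext2_decomposable z'.
  move=> /wedge_neq0_row_free vw_free /wedge_neq0_row_free/(row_free_transfer vw_free).
  case=> M uM; rewrite mul_col_mx => /eq_col_mx[vE wE].
  have [be beS beE] := wedge_similitude uM.
  by exists (mulmxr M), be => //; rewrite beE vE wE.
move=> u w /rV0Pn[i ui]; exists (fun x : 'rV[F]_3 => (x 0 i / u 0 i) *: w) => [x y|].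
  by rewrite mxE mulrDl scalerDl.
by rewrite divff // scale1r.
Qed.

End ExteriorSquare.

(** * Symplectic forms *)

(** Send a generator z of the small field to a root w in the large field of the
    minimal polynomial m of z over the prime field, that is, Q(z) to Q(w).  Such a
    root exists: m divides X^(p^n) - X, which splits in the large field, where
    the fixed points of x |-> x^(p^n) are p^n in number. *)
Lemma GF_embedding (p : prime_nat) (n b : nat) :
    (0 < n)%N -> (0 < b)%N -> (n %| b)%N ->
  exists2 io : GF p n -> GF p b,
    {morph io : x y / x + y} /\ {morph io : x y / x * y} & injective io.
Proof.
move=> n_gt0 b_gt0 nb; set F := GF p n; set L := GF p b.
pose F' := pPrimeCharType (GF_pchar p n).
pose L' := pPrimeCharType (GF_pchar p b).
pose fF : {rmorphism 'F_p -> F'} := in_alg F'.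
pose fL : {rmorphism 'F_p -> L'} := in_alg L'.
have [z z_prim] := @exists_primitive_root F _ (dvdnn _).
have cF : #|F| = (p ^ n)%N by exact: card_GF.
have pn_gt1 : (1 < p ^ n)%N by rewrite -(exp1n n) ltn_exp2r // prime_gt1 ?prime_pnat.
have [m mF mdvd] : exists2 m : {poly 'F_p}, (1 < size m)%N &
    forall Q, root (map_poly fF Q) z -> m %| Q.
  have /polyOver1P[m mE] := minPolyOver 1%AS (z : F').
  exists m.
    by rewrite -(size_map_poly fF) -[map_poly _ _]mE size_minPoly.
  move=> Q Qz; rewrite -(dvdp_map fF) -[map_poly _ m]mE.
  apply: minPoly_dvdp => //; by apply/polyOver1P; exists Q.
have [w mw] : exists w, root (map_poly fL m) w.
  pose P (K : nzRingType) : {poly K} := 'X^(p ^ n) - 'X.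
  have mP : m %| P _.
    apply: mdvd; rewrite /P rmorphB /= map_polyXn map_polyX /root !hornerE subr_eq0.
    by rewrite -cF expf_card.
  have {}mP : map_poly fL m %| P _.
    by move: mP; rewrite -(dvdp_map fL) /P [in X in _ %| X]rmorphB /= map_polyXn map_polyX.
  pose rs : seq L := [seq subGF_val x | x : subGF p b n].
  have PE : P L = lead_coef (P L) *: \prod_(x <- rs) ('X - x%:P).
    apply: all_roots_prod_XsubC.
    - rewrite size_image card_subGF // /P size_polyDl ?size_polyXn //.
      by rewrite size_polyN size_polyX ltnS.
    - apply/allP=> _ /imageP[x _ ->]; rewrite /root /P !hornerE subr_eq0.
      exact: (valP x).
    by rewrite uniq_rootsE map_inj_uniq ?enum_uniq //; exact: val_inj.
  have P0 : lead_coef (P L) != 0.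
    rewrite lead_coef_eq0 -size_poly_eq0 /P size_polyDl ?size_polyXn //.
    by rewrite size_polyN size_polyX ltnS.
  move: mP; rewrite PE dvdpZr // => /dvdp_prod_XsubC[msk mE].
  have := eqp_size mE; rewrite size_map_poly size_prod_XsubC.
  case: (mask msk rs) mE => [|a s] mE sz; first by rewrite sz in mF.
  by exists a; rewrite (eqp_root mE) big_cons rootM root_XsubC eqxx.
have hasQ (x : F') : exists Q, (map_poly fF Q).[z] == x.
  have [->|xn0] := eqVneq x 0; first by exists 0; rewrite rmorph0 horner0.
  have x1 : x ^+ #|F|.-1 = 1.
    have F_gt0 : (0 < #|F|)%N by rewrite cF expn_gt0 prime_gt0 ?prime_pnat.
    by apply: (mulfI xn0); rewrite -exprS prednK // mulr1; exact: expf_card.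
  have [i ->] := prim_rootP z_prim x1.
  by exists 'X^i; rewrite map_polyXn hornerXn.
pose io x := (map_poly fL (xchoose (hasQ x))).[w].
have ioE Q x : (map_poly fF Q).[z] = x -> io x = (map_poly fL Q).[w].
  move=> Qx; apply/eqP; rewrite -subr_eq0 -hornerN -hornerD -rmorphN -rmorphD.
  rewrite -/(root _ w); set D := _ - _.
  suff /dvdpP[R ->] : m %| D by rewrite rmorphM rootM mw orbT.
  apply: mdvd; rewrite /root rmorphD rmorphN hornerD hornerN Qx subr_eq0.
  exact: (xchooseP (hasQ x)).
have ioP x : (map_poly fF (xchoose (hasQ x))).[z] = x.
  by apply/eqP; exact: (xchooseP (hasQ x)).
have ioD : {morph io : x y / (x : F') + y >-> (x : L') + y}.
  move=> x y; rewrite (ioE (xchoose (hasQ x) + xchoose (hasQ y))).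
    by rewrite rmorphD hornerD.
  by rewrite rmorphD hornerD !ioP.
have ioM : {morph io : x y / (x : F') * y >-> (x : L') * y}.
  move=> x y; rewrite (ioE (xchoose (hasQ x) * xchoose (hasQ y))).
    by rewrite rmorphM hornerM.
  by rewrite rmorphM hornerM !ioP.
have io1 : io 1 = 1 by rewrite (ioE 1) rmorph1 hornerC.
exists io => // x y ioxy; apply/eqP; rewrite -subr_eq0; apply: contraT => xyn0.
have /eqP := io1; rewrite -(divff xyn0) ioM ioD.
have -> : io (- y) = - io y.
  by apply/eqP; rewrite -addr_eq0 -ioD addNr (ioE 0) ?rmorph0 ?horner0.
by rewrite ioxy subrr mul0r eq_sym oner_eq0.
Qed.

Lemma ord2_cases (a : 'I_2) : a = 0 \/ a = 1.
Proof. by case: a => -[|[|a]] // lt_a; [left | right]; apply: val_inj. Qed.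

Section StandardSymplectic.

Variables (F : finFieldType) (k : nat).
Local Notation E := 'M[F]_(2, k).

Definition symp (u w : E) : F := \sum_i (u 0 i * w 1 i - u 1 i * w 0 i).

Fact sympDl u v w : symp (u + v) w = symp u w + symp v w.
Proof. by rewrite /symp -big_split; apply: eq_bigr => i _; rewrite !mxE /=; ring. Qed.

Fact sympDr u v w : symp u (v + w) = symp u v + symp u w.
Proof. by rewrite /symp -big_split; apply: eq_bigr => i _; rewrite !mxE /=; ring. Qed.

(** The two rows of a matrix are the coordinates along two complementary
    Lagrangian subspaces. *)
Definition heisenberg : finGroupType :=
  cocycle_group (Biadditive sympDl sympDr).

End StandardSymplectic.

Section Symplectic.

Variables (F : finFieldType) (V : finZmodType).
(* The action s is not assumed to be a module structure: the axioms follow from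
   nondegeneracy.  This covers a subfield acting through an embedding. *)
Variables (f : biadditive V F) (s : F -> V -> V).
Hypothesis f_alt : forall v, f v v = 0.
Hypothesis f_scale : forall c v w, f (s c v) w = c * f v w.
Hypothesis f_nondeg : forall v, (forall w, f v w = 0) -> v = 0.

Lemma altC v w : f w v = - f v w.
Proof.
apply/eqP; rewrite -addr_eq0 addrC.
by have := f_alt (v + w); rewrite bfunDl !bfunDr !f_alt addr0 add0r => ->.
Qed.

Lemma f_inj v v' : (forall w, f v w = f v' w) -> v = v'.
Proof.
move=> E; apply/eqP; rewrite -subr_eq0; apply/eqP/f_nondeg => w.
by rewrite bfunDl bfunNl E subrr.
Qed.

Lemma f_scaler c v w : f v (s c w) = c * f v w.
Proof. by rewrite altC f_scale altC mulrN opprK. Qed.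

Lemma scale_addl c d v : s (c + d) v = s c v + s d v.
Proof. by apply: f_inj => u; rewrite bfunDl !f_scale mulrDl. Qed.

Lemma f_neq0 v : v != 0 -> exists w, f v w != 0.
Proof.
move=> vn0; have [w fvw|f0] := pickP (fun w => f v w != 0); first by exists w.
by case/eqP: vn0; apply: f_nondeg => w; have /eqP := negbFE (f0 w).
Qed.

Definition isometry al :=
  {morph al : x y / x + y} /\ forall x y, f (al x) (al y) = f x y.

Lemma isometry_inj al : isometry al -> injective al.
Proof. by case=> _ alf v v' E; apply: f_inj => w; rewrite -alf E alf. Qed.

Lemma isometry_comp al al' : isometry al -> isometry al' -> isometry (al' \o al).
Proof.
by case=> alD alf [al'D al'f]; split=> x y /=; rewrite ?alD ?al'D ?al'f ?alf.
Qed.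

Lemma transvection_isometry a u : isometry (fun v => v + s (a * f v u) u).
Proof.
split=> x y; first by rewrite bfunDl mulrDr scale_addl addrACA.
by rewrite bfunDl !bfunDr !f_scale !f_scaler f_alt [f u y]altC; ring.
Qed.

(** When f v w is not 0, a transvection along w - v takes v to w; otherwise go
    through a z that is orthogonal to neither. *)
Lemma isometry_transitive v w : v != 0 -> w != 0 ->
  exists2 al, isometry al & al v = w.
Proof.
have step x y : f x y != 0 -> exists2 al, isometry al & al x = y.
  move=> xy; pose u := y - x.
  exists (fun v => v + s ((f x y)^-1 * f v u) u).
    exact: transvection_isometry.
  have fxu : f x u = f x y by rewrite bfunDr [f x (- x)]altC bfunNl f_alt !oppr0 addr0.
  rewrite fxu mulVf //.
  have -> : s 1 u = u by apply: f_inj => z; rewrite f_scale mul1r.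
  by rewrite addrC subrK.
move=> vn0 wn0.
have [z vz wz] : exists2 z, f v z != 0 & f z w != 0.
  have [z1 vz1] := f_neq0 vn0; have [z2 wz2] := f_neq0 wn0.
  have [wz1|wz1] := eqVneq (f w z1) 0; last by exists z1; rewrite ?[f z1 w]altC ?oppr_eq0.
  have [vz2|vz2] := eqVneq (f v z2) 0; last by exists z2; rewrite ?[f z2 w]altC ?oppr_eq0.
  exists (z1 + z2); first by rewrite bfunDr vz2 addr0.
  by rewrite altC bfunDr wz1 add0r oppr_eq0.
have [al1 al1P al1v] := step v z vz; have [al2 al2P al2v] := step z w wz.
by exists (al2 \o al1); [exact: isometry_comp | rewrite /= al1v al2v].
Qed.

Definition hyperbolic k (e : {ffun 'I_k -> V * V}) :=
  [forall i, forall j, [&& f (e i).1 (e j).1 == 0, f (e i).2 (e j).2 == 0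
     & f (e i).1 (e j).2 == (i == j)%:R]].

Lemma hyperbolicP k (e : {ffun 'I_k -> V * V}) :
  reflect (forall i j, [/\ f (e i).1 (e j).1 = 0, f (e i).2 (e j).2 = 0
     & f (e i).1 (e j).2 = (i == j)%:R]) (hyperbolic e).
Proof.
apply: (iffP forallP) => [eH i j|eH i].
  by have /forallP/(_ j)/and3P[/eqP ? /eqP ? /eqP ?] := eH i.
by apply/forallP=> j; have [-> -> ->] := eH i j; rewrite !eqxx.
Qed.

Definition hyp_comb k (e : {ffun 'I_k -> V * V}) (u : 'M[F]_(2, k)) : V :=
  \sum_i (s (u 0 i) (e i).1 + s (u 1 i) (e i).2).

Lemma f_suml I (r : seq I) P (E : I -> V) w :
  f (\sum_(i <- r | P i) E i) w = \sum_(i <- r | P i) f (E i) w.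
Proof.
by apply: (big_morph (f^~ w)) => [x y|]; rewrite ?bfunDl ?bfun0l.
Qed.

Section Hyperbolic.

Variables (k : nat) (e : {ffun 'I_k -> V * V}).
Hypothesis eH : hyperbolic e.

Lemma hyp_comb1 u j : f (hyp_comb e u) (e j).1 = - u 1 j.
Proof.
have /hyperbolicP eP := eH; rewrite /hyp_comb f_suml (bigD1 j) //=.
rewrite big1 ?addr0 => [|i ij]; rewrite bfunDl !f_scale [f (e _).2 _]altC.
  by have [-> _ ->] := eP j j; rewrite eqxx /=; ring.
by have [-> _ _] := eP i j; have [_ _ ->] := eP j i; rewrite eq_sym (negbTE ij) /=; ring.
Qed.

Lemma hyp_comb2 u j : f (hyp_comb e u) (e j).2 = u 0 j.
Proof.
have /hyperbolicP eP := eH; rewrite /hyp_comb f_suml (bigD1 j) //=.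
rewrite big1 ?addr0 => [|i ij]; rewrite bfunDl !f_scale.
  by have [_ -> ->] := eP j j; rewrite eqxx /=; ring.
by have [_ -> ->] := eP i j; rewrite (negbTE ij) /=; ring.
Qed.

Lemma hyp_combM u w : f (hyp_comb e u) (hyp_comb e w) = symp u w.
Proof.
rewrite altC {2}/hyp_comb f_suml -sumrN; apply: eq_bigr => i _.
rewrite bfunDl !f_scale ![f _ (hyp_comb _ _)]altC hyp_comb1 hyp_comb2; ring.
Qed.

Lemma hyp_combD : {morph hyp_comb e : u w / u + w}.
Proof.
move=> u w; rewrite /hyp_comb -big_split; apply: eq_bigr => i _ /=.
by rewrite !mxE !scale_addl addrACA.
Qed.

Lemma hyp_comb_inj : injective (hyp_comb e).
Proof.
move=> u w E; apply/matrixP=> a j; have [->|->] := ord2_cases a.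
  by rewrite -!hyp_comb2 E.
by apply: oppr_inj; rewrite -!hyp_comb1 E.
Qed.

Lemma hyp_card : (#|F| ^ (2 * k) <= #|V|)%N.
Proof.
apply: leq_trans (leq_card _ hyp_comb_inj).
by rewrite card_mx.
Qed.

Lemma hyp_project v : exists u, forall j,
  f (v - hyp_comb e u) (e j).1 = 0 /\ f (v - hyp_comb e u) (e j).2 = 0.
Proof.
exists (\matrix_(a, i) if a == 0 then f v (e i).2 else - f v (e i).1) => j.
by rewrite !bfunDl !bfunNl hyp_comb1 hyp_comb2 !mxE opprK !subrr.
Qed.

(** A vector v outside the span, minus its projection, is orthogonal to the span;
    nondegeneracy provides a partner for it, which is projected in turn. *)
Lemma hyp_extend v : (forall u, hyp_comb e u != v) ->
  exists e' : {ffun 'I_k.+1 -> V * V}, hyperbolic e'.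
Proof.
move=> v_out; have [u uP] := hyp_project v; set v0 := v - _ in uP.
have v0n0 : v0 != 0 by rewrite subr_eq0 eq_sym.
have [w v0w] := f_neq0 v0n0; have [u' u'P] := hyp_project w.
pose w0 := s (f v0 w)^-1 (w - hyp_comb e u').
have v0comb x : f v0 (hyp_comb e x) = 0.
  rewrite altC f_suml big1 ?oppr0 // => i _; rewrite bfunDl !f_scale.
  by have [E1 E2] := uP i; rewrite ![f _ v0]altC E1 E2 oppr0 !mulr0 addr0.
have v0w0 : f v0 w0 = 1.
  rewrite f_scaler bfunDr [f v0 (- _)]altC bfunNl opprK [f _ v0]altC v0comb.
  by rewrite oppr0 addr0 mulVf.
have w0e j : f w0 (e j).1 = 0 /\ f w0 (e j).2 = 0.
  by have [E1 E2] := u'P j; rewrite !f_scale E1 E2 !mulr0.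
exists [ffun i => if unlift ord0 i is Some j then e j else (v0, w0)].
have /hyperbolicP eP := eH; apply/hyperbolicP=> i j; rewrite !ffunE.
case: unliftP => [i' ->|->]; case: unliftP => [j' ->|->] /=.
- by have [-> -> ->] := eP i' j'; rewrite (inj_eq lift_inj).
- have [E1 E2] := uP i'; have [E3 E4] := w0e i'.
  by split; rewrite [LHS]altC ?E1 ?E3 ?E4 oppr0.
- have [E1 E2] := uP j'; have [E3 E4] := w0e j'.
  by rewrite E1 E2 E4.
by rewrite !f_alt v0w0.
Qed.

End Hyperbolic.

(** As long as j < k, the |F|^(2j) elements of the span of j hyperbolic pairs do
    not exhaust V, so there is room for another pair. *)
Lemma symplectic_basis k : #|V| = (#|F| ^ (2 * k))%N ->
  exists g : 'M[F]_(2, k) -> V, [/\ {morph g : u w / u + w},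
    injective g & forall u w, f (g u) (g w) = symp u w].
Proof.
move=> cardV; have F_gt1 : (1 < #|F|)%N := finNzRing_gt1 _.
suff [e eH] : exists e : {ffun 'I_k -> V * V}, hyperbolic e.
  exists (hyp_comb e); split; [exact: hyp_combD | exact: hyp_comb_inj |].
  exact: hyp_combM.
have : forall j, (j <= k)%N -> exists e : {ffun 'I_j -> V * V}, hyperbolic e.
  elim=> [_|j IHj lt_jk].
    by exists [ffun=> (0, 0)]; apply/hyperbolicP=> -[].
  have [e eH] := IHj (ltnW lt_jk).
  suff /existsP[v /forallP v_out] : [exists v, forall u, hyp_comb e u != v].
    exact: hyp_extend v_out.
  apply: contraT; rewrite negb_exists => /forallP nv.
  have /eqP : #|V| = (#|F| ^ (2 * j))%N.
    apply/eqP; rewrite eqn_leq (hyp_card eH) andbT.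
    have -> : (#|F| ^ (2 * j))%N = #|{: 'M[F]_(2, j)}| by rewrite card_mx.
    rewrite -(card_imset _ (hyp_comb_inj eH)); apply/subset_leq_card/subsetP=> v _.
    by have := nv v; rewrite negb_forall => /existsP[u /negbNE/eqP <-]; apply: imset_f.
  by rewrite cardV eqn_exp2l // eqn_pmul2l // gtn_eqF.
by move/(_ k (leqnn k)).
Qed.

End Symplectic.

Section Heisenberg.

Variables (F : finFieldType) (k : nat).
Hypotheses (k_gt0 : (0 < k)%N) (F2 : 2%:R != 0 :> F).
Local Notation E := 'M[F]_(2, k).
Local Notation b := (Biadditive (@sympDl F k) (@sympDr F k)).

Lemma symp_alt (u : E) : symp u u = 0.
Proof. by rewrite /symp big1 // => i _; rewrite mulrC subrr. Qed.

Lemma symp_scale c (u w : E) : symp (c *: u) w = c * symp u w.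
Proof. by rewrite /symp mulr_sumr; apply: eq_bigr => i _; rewrite !mxE; ring. Qed.

Lemma symp_nondegenerate (u : E) : (forall w, symp u w = 0) -> u = 0.
Proof.
move=> u0; apply/matrixP=> a j; rewrite mxE.
have [->|->] := ord2_cases a.
  have := u0 (delta_mx 1 j); rewrite /symp (bigD1 j) //= big1 => [|i ij].
    by rewrite !mxE !eqxx /= mulr0 mulr1 subr0 addr0.
  by rewrite !mxE (negbTE ij) !mulr0 subrr.
have := u0 (delta_mx 0 j); rewrite /symp (bigD1 j) //= big1 => [|i ij].
  by rewrite !mxE !eqxx /= mulr0 mulr1 sub0r addr0 => /eqP; rewrite oppr_eq0 => /eqP.
by rewrite !mxE (negbTE ij) !mulr0 subrr.
Qed.

Lemma heisenberg_nondegenerate : commutator_nondegenerate b.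
Proof.
move=> u uC; apply: symp_nondegenerate => w; have /eqP := uC w.
rewrite /= -[symp w u]opprK -[- symp w u](altC (f := b) symp_alt) -addr_eq0.
by rewrite -mulr2n -mulr_natl mulf_eq0 (negbTE F2) => /eqP.
Qed.

(** Transvections are transitive on nonzero vectors, and scaling one Lagrangian
    half multiplies the form by any nonzero scalar. *)
Lemma three_orbit_heisenberg : three_orbit (heisenberg F k).
Proof.
pose u0 : E := delta_mx 0 (Ordinal k_gt0).
have u0n0 : u0 != 0.
  by apply/eqP => /matrixP/(_ 0 (Ordinal k_gt0))/eqP; rewrite !mxE !eqxx oner_eq0.
apply: (@three_orbit_cocycle _ _ b u0 1) => //.
- exact: oner_neq0.
- exact: heisenberg_nondegenerate.
- move=> u u' un0 u'n0.
  have [al [alD alf] alu] := isometry_transitive (f := b) (s := *:%R)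
    symp_alt symp_scale symp_nondegenerate un0 u'n0.
  have al_inj := isometry_inj (f := b) symp_nondegenerate (conj alD alf).
  by exists al, id => //; split=> // x y; exact: alf.
- move=> c c' cn0 c'n0; pose mu := c' / c.
  have mun0 : mu != 0 by rewrite mulf_neq0 ?invr_eq0.
  exists (fun u : E => \matrix_(a, i) if a == 0 then u 0 i else mu * u 1 i).
  exists ( *%R mu); last by rewrite divfK.
  split; [ | exact: mulrDr | | exact: mulfI | ].
  - by move=> u w; apply/matrixP=> a i; rewrite !mxE; case: (a == 0); rewrite ?mulrDr.
  - move=> u w /matrixP uw; apply/matrixP=> a i.
    by have := uw a i; rewrite !mxE; have [->|->] := ord2_cases a => // /(mulfI mun0).
  by move=> u w; rewrite /= /symp mulr_sumr; apply: eq_bigr => i _; rewrite !mxE /=; ring.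
move=> u c /(f_neq0 (f := b) symp_nondegenerate)[w uw].
exists (fun x => b x w / b u w * c) => [x y|]; last by rewrite divff ?mul1r.
by rewrite bfunDl !mulrDl.
Qed.

End Heisenberg.

Section FormGroup.

Variables (p : prime_nat) (n b j k : nat) (nb : (n %| b)%N).
Hypotheses (n_gt0 : (0 < n)%N) (b_gt0 : (0 < b)%N).
Hypothesis dimE : (b * j = n * (2 * k))%N.
Variable f : {biscalar 'rV[GF p b]_j}.
Hypotheses (f_alt : alternating f) (f_nondeg : nondegenerate_form f).
Local Notation L := (GF p b).
Local Notation F := (GF p n).
Local Notation W := (subGF p b n).

Let p_gt1 : (1 < p)%N. Proof. exact: prime_gt1 (prime_pnat p). Qed.

(** The trace is a polynomial of degree less than p^b whose coefficient at X is 1. *)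
Lemma trace_neq0 : exists x : L, trace nb x != 0.
Proof.
pose P : {poly L} := \sum_(i < b %/ n) 'X^((p ^ n) ^ i).
have bn_gt0 : (0 < b %/ n)%N by rewrite divn_gt0 // dvdn_leq.
have Pn0 : P != 0.
  apply/eqP => /(congr1 (fun Q : {poly L} => Q`_1)); rewrite coef0 coef_sum.
  rewrite (bigD1 (Ordinal bn_gt0)) //= coefXn expn0 eqxx big1 ?addr0.
    by move/eqP; rewrite oner_eq0.
  move=> i; rewrite -val_eqE /= coefXn => i_n0.
  rewrite -{1}(expn0 (p ^ n)) eqn_exp2l ?(eq_sym 0%N) ?(negbTE i_n0) //.
  by rewrite -(exp1n n) ltn_exp2r.
have szP : (size P <= (p ^ (n * (b %/ n).-1)).+1)%N.
  apply: leq_trans (size_sum _ _ _) _; apply/bigmax_leqP => i _.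
  rewrite size_polyXn ltnS -expnM leq_exp2l // leq_mul2l.
  by rewrite -ltnS prednK // ltn_ord orbT.
have [x xP|P0] := pickP (fun x => ~~ root P x).
  exists x; apply: contraNneq xP => /(congr1 val) /= tx.
  by rewrite /root horner_sum -[X in _ == X]tx; apply/eqP/eq_bigr => i _; rewrite hornerXn.
have := max_poly_roots Pn0 _ (enum_uniq L); rewrite -cardE card_GF //.
have -> : all (root P) (enum L) by apply/allP=> x _; exact: negbFE (P0 x).
move=> /(_ isT) /leq_trans/(_ szP); rewrite ltnS leq_exp2l // leqNgt => /negP[].
rewrite -{2}(divnK nb) mulnC ltn_pmul2r //.
by rewrite prednK.
Qed.

(** Seen over the small field through the embedding io, the composite of f with
    the trace is again a nondegenerate alternating form, hence has a symplectic
    basis of the size dictated by the order of the space. *)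
Lemma form_group_heisenberg :
  [set: heisenberg F k] \isog [set: form_group nb f].
Proof.
have [io [ioD ioM] io_inj] := GF_embedding p n_gt0 b_gt0 nb.
have ioX x i : io (x ^+ i.+1) = io x ^+ i.+1.
  by elim: i => [|i IH] //; rewrite exprS ioM IH -exprS.
have pn_gt0 : (0 < p ^ n)%N by rewrite expn_gt0 ltnW.
have ioP c : io c ^+ (p ^ n) = io c by rewrite -(prednK pn_gt0) -ioX prednK // GF_exp_card.
have ioW c : io c \in @subGF_pred p b n by rewrite inE ioP.
pose ioT c : W := SubGF (ioW c).
have ioT_inj : injective ioT by move=> c d /(congr1 val)/io_inj.
have cardW : #|{: W}| = #|F| by rewrite card_subGF // card_GF.
have [g ioTK gK] : bijective ioT by apply: inj_card_bij; rewrite ?cardW.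
have ioTD : {morph ioT : c d / c + d} by move=> c d; apply: val_inj; exact: ioD.
have gD : {morph g : c d / c + d}.
  by move=> c d; apply: (can_inj ioTK); rewrite ioTD !gK.
have traceZ c x : trace nb (io c * x) = ioT (c * g (trace nb x)).
  apply: val_inj; rewrite /= ioM -[io (g _)]/(val (ioT (g _))) gK /= mulr_sumr.
  apply: eq_bigr => i _; rewrite exprMn; congr (_ * _).
  by elim: (i : nat) => [|i' IH]; rewrite ?expr1 // expnSr exprM IH ioP.
have hDl v w x : g (trace nb (f (v + w) x)) = g (trace nb (f v x)) + g (trace nb (f w x)).
  by rewrite linearDl traceD gD.
have hDr v w x : g (trace nb (f v (w + x))) = g (trace nb (f v w)) + g (trace nb (f v x)).
  by rewrite linearD traceD gD.
pose h : biadditive 'rV[L]_j F := Biadditive hDl hDr.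
pose s (c : F) (v : 'rV[L]_j) := io c *: v.
have trace0 := morph0 (traceD nb).
have g0 := morph0 gD.
have h_alt v : h v v = 0 by rewrite /= f_alt trace0 g0.
have h_scale c v w : h (s c v) w = c * h v w.
  by rewrite /= /s linearZl_LR /= traceZ ioTK.
have h_nondeg v : (forall w, h v w = 0) -> v = 0.
  move=> v0; apply: f_nondeg => w; apply/eqP; apply: contraT => fvw.
  have [x /negP[]] := trace_neq0; rewrite -[x](divfK fvw).
  have := v0 ((x / f v w) *: w); rewrite /= linearZr_LR /= => /(congr1 ioT).
  by rewrite gK -g0 gK => ->.
have cardV : #|{: 'rV[L]_j}| = (#|F| ^ (2 * k))%N.
  by rewrite card_mx !card_GF // mul1n -!expnM dimE.
have [al [alD al_inj alE]] := symplectic_basis h_alt h_scale h_nondeg cardV.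
apply: (@cocycle_isog _ _ _ _ _ _ al ioT (fun=> 0)) => //.
  by rewrite cardV card_mx.
by move=> x y; rewrite /= !addr0 -alE /= gK.
Qed.

End FormGroup.

(** * Comparing the families *)

Lemma GF_odd_neq2 (p : prime_nat) n : odd p -> 2%:R != 0 :> GF p n.
Proof.
move=> p_odd; rewrite -(dvdn_pcharf (GF_pchar p n)) gtnNdvd //.
by rewrite odd_gt2 ?prime_gt1 ?prime_pnat.
Qed.

Lemma even_divn (n b m : nat) :
  (n %| b)%N -> (b %| m)%N -> ~~ odd (m %/ b) -> ~~ odd (m %/ n).
Proof.
move=> nb bm mb_even; have -> : (m %/ n = (m %/ b) * (b %/ n))%N.
  by rewrite muln_divA ?divnK.
by rewrite oddM (negbTE mb_even).
Qed.

Lemma form_choice_heisenberg (c : choices) (p : prime_nat) (n b m : nat)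
    (nb : (n %| b)%N) :
    odd p -> (0 < m)%N -> (b %| m)%N -> ~~ odd (m %/ b) ->
  [set: form_group nb (Defs.form c p b (m %/ b))]
    \isog [set: heisenberg (GF p n) (m %/ n)./2].
Proof.
move=> p_odd m_gt0 bm mb_even; have b_gt0 := dvdn_gt0 m_gt0 bm.
have n_gt0 := dvdn_gt0 b_gt0 nb; rewrite isog_sym.
apply: form_group_heisenberg => //.
- have mn_even := even_divn nb bm mb_even.
  rewrite mulnC divnK // mul2n (even_halfK mn_even) mulnC divnK //.
  exact: dvdn_trans nb bm.
- exact: form_alternating.
exact: form_nondegenerate.
Qed.

Lemma card_heisenberg F k : #|[set: heisenberg F k]| = (#|F| ^ (2 * k).+1)%N.
Proof. by rewrite card_cocycle_group card_mx expnSr. Qed.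

(** Triples (p, a, z) such that the group has order p^a and its centre p^z; the
    affine groups, which are not p-groups, get a dummy value. *)
Definition signature (l : label) : nat * nat * nat :=
  match l with
  | List1 p n => (p : nat, 2 * n, 2 * n)
  | List2 _ _ _ => (0, 0, 0)
  | List3 n _ => (2, 2 * n, n)
  | List4 n => (2, 3 * n, n)
  | List5 => (2, 9, 3)
  | List6 p k => (p : nat, 6 * k, 3 * k)
  | List7 p n m => (p : nat, n + m, n)
  end%N.

Definition is_pgroup_label (l : label) := if l is List2 _ _ _ then false else true.

Lemma signatureP (c : choices) (l : label) (s := signature l) :
    listed l -> is_pgroup_label l ->
  [/\ prime s.1.1, (0 < s.2)%N, (0 < s.1.2)%N,
      #|[set: list_group c l]| = (s.1.1 ^ s.1.2)%N
    & #|'Z([set: list_group c l])%g| = (s.1.1 ^ s.2)%N].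
Proof.
rewrite {}/s; case: l => //=.
- move=> p n n_gt0 _; rewrite homocyclic_p2_center card_homocyclic_p2.
  by split; rewrite ?prime_pnat ?muln_gt0.
- move=> n i [n_gt0 _ i_rng] _; split=> //; first by rewrite muln_gt0.
    by rewrite card_cocycle_group !card_GF // -expnD addnn mul2n.
  rewrite card_cocycle_center ?card_GF //.
  exact/A_nondegenerate/phiX_neq1.
- move=> n n_gt0 _; have n2_gt0 : (0 < 2 * n)%N by rewrite muln_gt0.
  split=> //; first by rewrite muln_gt0.
    by rewrite card_cocycle_group card_GF // card_subGF ?dvdn_mull // -expnD -mulSnr.
  rewrite card_cocycle_center; first by rewrite card_subGF ?dvdn_mull.
  exact/B_nondegenerate/epsB_order.
- move=> _ _; split=> //.
    by rewrite card_cocycle_group card_GF // card_subGF.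
  rewrite card_cocycle_center; first by rewrite card_subGF.
  exact/P_nondegenerate/epsP_order.
- move=> p k [p_odd k_gt0] _; split; rewrite ?prime_pnat ?muln_gt0 //.
    rewrite card_cocycle_group card_ext2 card_mx mul1n -expnD card_GF //.
    by rewrite -expnM mulnC.
  rewrite card_cocycle_center; first by rewrite card_ext2 card_GF // -expnM mulnC.
  exact/ext_nondegenerate/GF_odd_neq2.
move=> p n m [p_odd m_gt0 nm mn_even] _; have n_gt0 := dvdn_gt0 m_gt0 nm.
have isoH := form_choice_heisenberg c (dvdnn n) p_odd m_gt0 nm mn_even.
split; rewrite ?prime_pnat ?addn_gt0 ?n_gt0 //.
  rewrite (card_isog isoH) card_heisenberg card_GF // -expnM; congr (_ ^ _)%N.
  by rewrite mul2n (even_halfK mn_even) mulnS mulnC divnK.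
rewrite (card_isog (isog_center isoH)) card_cocycle_center ?card_GF //.
exact/heisenberg_nondegenerate/GF_odd_neq2.
Qed.

Lemma signature_isog (c : choices) (l1 l2 : label) :
    listed l1 -> listed l2 -> is_pgroup_label l1 -> is_pgroup_label l2 ->
    [set: list_group c l1] \isog [set: list_group c l2] ->
  signature l1 = signature l2.
Proof.
move=> listed1 listed2 pl1 pl2 iso12.
have [] := signatureP c listed1 pl1; have [] := signatureP c listed2 pl2.
rewrite -(card_isog iso12) -(card_isog (isog_center iso12)).
case: (signature l1) => [[p a] z]; case: (signature l2) => [[q a'] z'] /=.
move=> q_pr z'_gt0 a'_gt0 -> -> p_pr z_gt0 a_gt0 qp_a qp_z.
have pq : p = q.
  apply/eqP; rewrite -dvdn_prime2 //.
  have : (p %| q ^ a')%N by rewrite qp_a dvdn_exp.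
  by rewrite Euclid_dvdX // => /andP[].
move: qp_a qp_z; rewrite pq => /eqP; rewrite eqn_exp2l ?prime_gt1 // => /eqP->.
by move=> /eqP; rewrite eqn_exp2l ?prime_gt1 // => /eqP->.
Qed.

Lemma affine_not_prime_power (p r q : prime_nat) d a :
    p != r -> (0 < d)%N -> (r * p ^ (r.-1 * d) = q ^ a)%N -> False.
Proof.
move=> pr d_gt0 E; have r1_gt0 : (0 < r.-1)%N by have := prime_gt1 (prime_pnat r); lia.
have dvd_q (s : prime_nat) : (s %| r * p ^ (r.-1 * d))%N -> s = q.
  rewrite E Euclid_dvdX ?prime_pnat // => /andP[sq _].
  by apply: val_inj; apply/eqP; rewrite -dvdn_prime2 ?prime_pnat.
case/eqP: pr; rewrite (dvd_q r) ?dvdn_mulr // (dvd_q p) //.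
by rewrite dvdn_mull // dvdn_exp // muln_gt0 r1_gt0.
Qed.

(** p and r are the prime divisors of the order.  If they were exchanged, both
    (r-1)d and (r'-1)d' would be 1, so r = r' = 2 and p = r' = r. *)
Lemma affine_card_inj (p r p' r' : prime_nat) d d' :
    p != r -> p' != r' -> (0 < d)%N -> (0 < d')%N ->
    (r * p ^ (r.-1 * d) = r' * p' ^ (r'.-1 * d'))%N ->
  [/\ p = p', r = r' & d = d'].
Proof.
move=> pr p'r' d_gt0 d'_gt0 E.
have prime_pr (q : prime_nat) := prime_pnat q.
have r1_gt0 (q : prime_nat) : (0 < q.-1)%N by have := prime_gt1 (prime_pr q); lia.
have prime_dvd (q s : prime_nat) : (q %| s)%N = (q == s) by rewrite dvdn_prime2 ?prime_pr.
have dvdE (q s t : prime_nat) e : (0 < e)%N ->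
    (q %| s * t ^ (s.-1 * e))%N = (q == s) || (q == t).
  move=> e_gt0; rewrite Euclid_dvdM ?prime_pr // Euclid_dvdX ?prime_pr //.
  by rewrite muln_gt0 r1_gt0 e_gt0 !prime_dvd !andbT.
have logp (s t : prime_nat) : logn s t = (s == t).
  by rewrite logn_prime ?prime_pr // val_eqE.
have log_t (s t : prime_nat) e : t != s -> logn t (s * t ^ (s.-1 * e)) = (s.-1 * e)%N.
  move=> ts; rewrite lognM ?expn_gt0 ?prime_gt0 ?prime_pr // pfactorK ?prime_pr //.
  by rewrite logp (negbTE ts).
have log_s (s t : prime_nat) e : t != s -> logn s (s * t ^ (s.-1 * e)) = 1%N.
  move=> ts; rewrite lognM ?expn_gt0 ?prime_gt0 ?prime_pr // lognX !logp.
  by rewrite eqxx eq_sym (negbTE ts) muln0.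
have : (p == r') || (p == p') by rewrite -(dvdE _ _ _ d') // -E dvdE // eqxx orbT.
case/orP=> /eqP pE; last first.
  have /orP[/eqP rE|/eqP rE] : (r == r') || (r == p').
    by rewrite -(dvdE _ _ _ d') // -E dvdE // eqxx.
    split=> //; have := congr1 (logn p) E; rewrite log_t // pE rE log_t //.
    by move/eqP; rewrite eqn_pmul2l // => /eqP.
  by rewrite pE rE eqxx in pr.
have /orP[/eqP rE|/eqP rE] : (r == r') || (r == p').
  by rewrite -(dvdE _ _ _ d') // -E dvdE // eqxx.
  by rewrite pE rE eqxx in pr.
have := congr1 (logn p) E; rewrite log_t // {1}pE log_s // => rd1.
have := congr1 (logn p') E; rewrite -{1}rE log_s // log_t // => r'd1.
have r2 : r = two by apply: val_inj => /=; have := r1_gt0 r; lia.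
have r'2 : r' = two by apply: val_inj => /=; have := r1_gt0 r'; lia.
by rewrite pE r2 r'2 eqxx in pr.
Qed.

Lemma listed_three_orbit (c : choices) (l : label) :
  listed l -> three_orbit (list_group c l).
Proof.
case: l => [p n|p r d|n i|n||p k|p n m] /=.
- exact: three_orbit_homocyclic_p2.
- by case; exact: three_orbit_affine.
- case=> n_gt0 _ i_rng; apply: three_orbit_A; first exact: phiX_odd.
  exact: phiX_neq1.
- by move=> n_gt0; apply: three_orbit_B => //; exact: epsB_order.
- by move=> _; apply: three_orbit_P; exact: epsP_order.
- by case=> p_odd _; apply: three_orbit_ext; exact: GF_odd_neq2.
case=> p_odd m_gt0 nm mn_even.
apply: three_orbit_isog (form_choice_heisenberg c (dvdnn n) p_odd m_gt0 nm mn_even) _.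
apply: three_orbit_heisenberg; last exact: GF_odd_neq2.
have mn_gt0 : (0 < m %/ n)%N by rewrite divn_gt0 ?(dvdn_gt0 m_gt0) // dvdn_leq.
by rewrite half_gt0; case: (m %/ n)%N mn_gt0 mn_even => [|[|]].
Qed.

Lemma pgroup_not_isog_affine (c : choices) (p r : prime_nat) d l :
    listed (List2 p r d) -> listed l -> is_pgroup_label l ->
  ~~ ([set: list_group c (List2 p r d)] \isog [set: list_group c l]).
Proof.
move=> [pr p_prim d_gt0] listed_l pl; apply/negP => /card_isog.
have [q_pr _ _ -> _] := signatureP c listed_l pl.
rewrite card_affine_group //.
exact: (@affine_not_prime_power p r (PrimeNat q_pr)).
Qed.

(** The signature determines the label except for the parameter i of A(n, phi^i)
    and the coincidence of P with B(3). *)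
Lemma listed_isog_inj (c : choices) (l1 l2 : label) :
    listed l1 -> listed l2 ->
    [set: list_group c l1] \isog [set: list_group c l2] -> l1 = l2.
Proof.
move=> listed1 listed2 iso12.
have [p1|np1] := boolP (is_pgroup_label l1); last first.
  case: l1 np1 listed1 iso12 => // p r d _ listed1 iso12.
  have [p2|np2] := boolP (is_pgroup_label l2).
    by have /negP[] := pgroup_not_isog_affine c listed1 listed2 p2.
  case: l2 np2 listed2 iso12 => // p' r' d' _ [pr' pr'_prim d'_gt0].
  have [pr p_prim d_gt0] := listed1.
  move/card_isog; rewrite !card_affine_group // => /affine_card_inj.
  by case=> // -> -> ->.
have [p2|np2] := boolP (is_pgroup_label l2); last first.
  case: l2 np2 listed2 iso12 => // p r d _ listed2; rewrite isog_sym => iso12.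
  by have /negP[] := pgroup_not_isog_affine c listed2 listed1 p1.
have := signature_isog listed1 listed2 p1 p2 iso12.
case: l1 listed1 p1 iso12 => [p n|p r d|n i|n||p k|p n m] //= listed1 _;
case: l2 listed2 p2 => [p' n'|p' r' d'|n' i'|n'||p' k'|p' n' m'] //= listed2 _ iso12 [].
all: try by [lia | case: listed1 => *; lia | case: listed2 => *; lia].
- by move=> /val_inj-> ? ?; congr List1; lia.
- move=> _ nn'; move: listed2 iso12; rewrite -{}nn' => -[_ _ i'_rng] iso12.
  by case: listed1 => n_gt0 _ i_rng; rewrite (A_group_phi_inj n_gt0 i_rng i'_rng iso12).
- by move=> _ ->.
- move=> _ n3; move: iso12; rewrite n3 isog_sym => iso12.
  by case/negP: (P_B_not_isog (epsP_order c) (epsB_order c (isT : (0 < 3)%N))).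
- move=> _ n3; move: iso12; rewrite -n3 => iso12.
  by case/negP: (P_B_not_isog (epsP_order c) (epsB_order c (isT : (0 < 3)%N))).
- by move=> /val_inj-> ? ?; congr List6; lia.
- (* Here 6 k = n' + m' and 3 k = n', so m' / n' = 1 is odd. *)
  move=> _ E1 E2; case: listed2 => _ m'_gt0 _.
  have -> : m' = n' by lia.
  by rewrite divnn (_ : (0 < n')%N); lia.
- move=> _ E1 E2; case: listed1 => _ m_gt0 _.
  have -> : m = n by lia.
  by rewrite divnn (_ : (0 < n)%N); lia.
by move=> /val_inj-> ? ?; congr List7; lia.
Qed.

Lemma in_families_listed (c : choices) (G : finGroupType) : in_families c G ->
  exists l : label, listed l /\ [set: G] \isog [set: list_group c l].
Proof.
case=> [p n n_gt0|p r d pr p_prim d_gt0|n th n_gt0 n_pow th_odd th_gt1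
  |n n_gt0||p k p_odd k_gt0|p n b m nb p_odd m_gt0 bm mb_even].
- by exists (List1 p n); rewrite isog_refl.
- by exists (List2 p r d); rewrite isog_refl.
- have [i i_rng isoA] := A_group_listed n_gt0 th_odd th_gt1.
  by exists (List3 n i).
- by exists (List4 n); rewrite isog_refl.
- by exists List5; rewrite isog_refl.
- by exists (List6 p k); rewrite isog_refl.
have nm := dvdn_trans nb bm; have n_gt0 := dvdn_gt0 m_gt0 nm.
have mn_even := even_divn nb bm mb_even.
exists (List7 p n m); split=> //.
apply: isog_trans (form_choice_heisenberg c nb p_odd m_gt0 bm mb_even) _.
rewrite isog_sym; exact: form_choice_heisenberg.
Qed.

Theorem theorem6p5 (c : choices) :
  [/\ forall l : label, listed l -> three_orbit (list_group c l),
      forall l1 l2 : label, listed l1 -> listed l2 -> l1 <> l2 ->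
        ~~ ([set: list_group c l1] \isog [set: list_group c l2])
    & forall G : finGroupType, in_families c G ->
        exists l : label, listed l /\ [set: G] \isog [set: list_group c l]].
Proof.
split; [exact: listed_three_orbit | | exact: in_families_listed].
move=> l1 l2 listed1 listed2 l12; apply/negP => iso12; apply: l12.
exact: listed_isog_inj iso12.
Qed.
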